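(* Assume the setting and Assumption A in the context, and let $m_j$ be the means output by the Gaussian projected filter (Algorithm GPF) with inflation $Q=aP$. Then, if the inflation parameter $a>0$ is sufficiently large, there is a constant $\mathsf C_1$ independent of $\varepsilon$ such that $$\limsup_{j\to\infty}\mathbb E\|m_j-u_j\|\le\mathsf C_1\varepsilon.$$
   Context: $\mathcal H$ separable Hilbert space, $\Psi:\mathcal H\to\mathcal H$, $u_0\in\mathcal H$, signal $u_j=\Psi(u_{j-1})$. $H:\mathcal H\to\mathbb R^k$ linear with $HH^*=I_k$, $P:=H^*H$; observations $y_j=Hu_j+\varepsilon\eta_j$, $\varepsilon>0$, $\eta_j$ independent with mean zero and covariance $R$. $V(u):=(\|u\|^2+\beta\|Pu\|^2)^{1/2}$. Assumption A: there exist $r>0,\beta\ge0,L>0,\alpha\in(0,1)$ such that $\mathcal B=\{\|u\|\le r\}$ is absorbing and forward invariant for $\Psi$, $V^2(\Psi(u)-\Psi(v))\le LV^2(u-v)$ and $V^2((I-P)(\Psi(u)-\Psi(v)))\le\alpha V^2(u-v)$ for all $u,v\in\mathcal B$. $P_{\mathcal B_V}$: orthogonal projection onto $\mathcal B$ in the $V$-norm. $\mathscr K(\Sigma):=\Sigma H^*(H\Sigma H^*+\varepsilon^2R)^{-1}$. Algorithm GPF: given $m_0\in\mathcal H$ and covariance operator $C_0$; for $j\ge1$, $\mu_j=\mathbb E_{u\sim\mathcal N(m_{j-1},C_{j-1})}[\Psi(P_{\mathcal B_V}u)]$, $\Sigma_j=\mathbb E_{u\sim\mathcal N(m_{j-1},C_{j-1})}[(\Psi(P_{\mathcal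 B_V}u)-\mu_j)\otimes(\Psi(P_{\mathcal B_V}u)-\mu_j)]$, $m_j=\mu_j+\mathscr K(\Sigma_j+Q)(y_j-H\mu_j)$, $C_j=(I-\mathscr K(\Sigma_j+Q)H)(\Sigma_j+Q)$. The expectation is over the observation noise. *)

(* Defs.v *)
From HB Require Import structures.
From mathcomp Require Import all_boot all_order all_algebra.
From mathcomp Require Import all_classical all_reals all_analysis.
Set Implicit Arguments. Unset Strict Implicit. Unset Printing Implicit Defensive.
Import Order.TTheory GRing.Theory Num.Theory.
Import numFieldNormedType.Exports.
Local Open Scope classical_set_scope.
Local Open Scope ring_scope.

Definition hilbert_ip {R : realType} {V : completeNormedModType R}
  (ip : V -> V -> R) : Prop :=
  [/\ forall (c : R) (x y z : V), ip (c *: x + y) z = c * ip x z + ip y z,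
      forall x y : V, ip x y = ip y x
    & forall x : V, `|x| ^+ 2 = ip x x].

Definition separable_space {R : realType} (V : completeNormedModType R) : Prop :=
  exists S : set V, countable S /\ closure S = [set: V].

Definition borelV (V : topologicalType) := g_sigma_algebraType (@open V).

Definition gauss1 {R : realType} (m v : R) : set R -> \bar R :=
  if v == 0 then \d_ m else normal_prob m (Num.sqrt v).

Definition is_gaussian {R : realType} {V : completeNormedModType R}
  (ip : V -> V -> R) (G : probability (borelV V) R) (m : V) (C : V -> V) : Prop :=
  (forall (h : V) (A : set R), measurable A ->
     G ((fun x : borelV V => ip (x : V) h) @^-1` A) = gauss1 (ip m h) (ip (C h) h) A)
  /\ (forall h l : V,
     (\int[G]_x ((ip ((x : V) - m) h) * (ip ((x : V) - m) l))%:E)%E = (ip (C h) l)%:E).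

Definition Vnorm {R : realType} {V : completeNormedModType R}
  (beta : R) (Pm : V -> V) (u : V) : R :=
  Num.sqrt (`|u| ^+ 2 + beta * `|Pm u| ^+ 2).

Definition assumptionA {R : realType} {V : completeNormedModType R}
  (Psi : V -> V) (Pm : V -> V) (r beta L alpha : R) : Prop :=
  [/\ 0 < r, 0 <= beta, 0 < L & 0 < alpha < 1] /\
  [/\
      (forall rho : R, exists n : nat, forall (j : nat) (u : V),
          (n <= j)%N -> `|u| <= rho -> `|iter j Psi u| <= r),
      (forall u : V, `|u| <= r -> `|Psi u| <= r),
      (forall u v : V, `|u| <= r -> `|v| <= r ->
          Vnorm beta Pm (Psi u - Psi v) ^+ 2 <= L * Vnorm beta Pm (u - v) ^+ 2)
    & (forall u v : V, `|u| <= r -> `|v| <= r ->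
          Vnorm beta Pm ((Psi u - Psi v) - Pm (Psi u - Psi v)) ^+ 2
            <= alpha * Vnorm beta Pm (u - v) ^+ 2)].

Definition is_Vproj_ball {R : realType} {V : completeNormedModType R}
  (beta : R) (Pm : V -> V) (r : R) (PB : V -> V) : Prop :=
  forall u : V, `|PB u| <= r /\
    (forall v : V, `|v| <= r -> Vnorm beta Pm (u - PB u) <= Vnorm beta Pm (u - v)).

(* ---------- Kalman gain K(S) = S H^* (H S H^* + eps^2 R)^{-1} ---------- *)
Definition Kgain {R : realType} {V : completeNormedModType R} {k : nat}
  (H : V -> 'cV[R]_k) (Hs : 'cV[R]_k -> V) (eps : R) (Rm : 'M[R]_k)
  (S : V -> V) (y : 'cV[R]_k) : V :=
  let M := \matrix_(i, l) ((H (S (Hs (delta_mx l 0)))) i 0 + eps ^+ 2 * Rm i l) in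
  S (Hs (invmx M *m y)).

Definition indep_noise {R : realType} {d : measure_display} {Om : measurableType d}
  (P : probability Om R) {k : nat} (eta : nat -> Om -> 'cV[R]_k) : Prop :=
  forall (s : seq nat) (A : nat -> 'I_k -> set R),
    uniq s -> (forall j i, measurable (A j i)) ->
    P [set w | forall j, j \in s -> forall i, A j i (eta j w i ord0)]
    = (\prod_(j <- s) P [set w | forall i, A j i (eta j w i ord0)])%E.

Definition noise_model {R : realType} {d : measure_display} {Om : measurableType d}
  (P : probability Om R) {k : nat} (eta : nat -> Om -> 'cV[R]_k) (Rm : 'M[R]_k) : Prop :=
  [/\ forall j i, measurable_fun setT (fun w => eta j w i ord0),
      forall j i, P.-integrable setT (fun w => (eta j w i ord0)%:E)
                  /\ (\int[P]_w (eta j w i ord0)%:E = 0)%E,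
      forall j i l, P.-integrable setT (fun w => (eta j w i 0 * eta j w l ord0)%:E)
                  /\ (\int[P]_w (eta j w i 0 * eta j w l ord0)%:E = (Rm i l)%:E)%E
    & indep_noise P eta].

Definition GPF {R : realType} {V : completeNormedModType R} {k : nat}
  {d : measure_display} {Om : measurableType d}
  (ip : V -> V -> R) (H : V -> 'cV[R]_k) (Hs : 'cV[R]_k -> V) (Rm : 'M[R]_k)
  (eps a : R) (Psi PB : V -> V) (m0 : V) (C0 : V -> V)
  (y : nat -> Om -> 'cV[R]_k)
  (G : nat -> Om -> probability (borelV V) R)
  (m : nat -> Om -> V) (C : nat -> Om -> V -> V)
  (mu : nat -> Om -> V) (Sig : nat -> Om -> V -> V) : Prop :=
  forall w : Om,
  let S j := fun x : V => Sig j w x + a *: Hs (H x) in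
  [/\ m 0%N w = m0, C 0%N w = C0 &
      forall j, is_gaussian ip (G j w) (m j w) (C j w)] /\
  [/\ forall j, is_gaussian ip (G j w) (m j w) (C j w),
      forall j (h : V), (\int[G j w]_x (ip (Psi (PB (x : V))) h)%:E)%E
                        = (ip (mu j.+1 w) h)%:E,
      forall j (h l : V),
        (\int[G j w]_x ((ip (Psi (PB (x : V)) - mu j.+1 w) h)
                        * (ip (Psi (PB (x : V)) - mu j.+1 w) l))%:E)%E
        = (ip (Sig j.+1 w h) l)%:E,
      forall j, m j.+1 w = mu j.+1 w
                  + Kgain H Hs eps Rm (S j.+1) (y j.+1 w - H (mu j.+1 w))
    & forall j, C j.+1 w = (fun x => S j.+1 x - Kgain H Hs eps Rm (S j.+1) (H (S j.+1 x)))].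

(* Main.v *)
Require Import Defs.
From HB Require Import structures.
From mathcomp Require Import all_boot all_order all_algebra.
From mathcomp Require Import all_classical all_reals all_analysis.
From mathcomp Require Import measurable_realfun ring lra.
Import Order.TTheory GRing.Theory Num.Theory.
Import numFieldNormedType.Exports.
Local Open Scope classical_set_scope.
Local Open Scope ring_scope.

(* Write P = H^* H and Q = I - P.  The law N(m_j, C_j) enters only through its
   second moments about m_j.  The analysis covariance satisfies
   <C H^*y, H^*y> <= eps^2 <y, R y> whatever the forecast, and in the range of Q
   it is at most Sigma, where the forecast contracts by alpha.  Hence
   T_j = E V^2(u - m_j), u ~ N(m_j, C_j), obeys
   T_{j+1} <= alpha T_j + (1 + beta) eps^2 tr R and is eventually O(eps^2),
   uniformly in the noise.  As for the means, m_{j+1} - u_{j+1} equals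
   Q e + (P - K H) e + eps K eta with e the forecast error, and for eps <= 1 the
   inflation makes the norm of P - K H of order 1/a, so that for large a
   V(m_{j+1} - u_{j+1}) <= gamma (V(m_j - u_j) + O(eps)) + O(eps) |eta_{j+1}|
   with gamma < 1.  For eps > 1 the error is at most a constant plus
   O(eps) |eta|, which is enough. *)

(** The spread is treated before the means because [Psi] is nonlinear: the forecast mean averages
    over the law instead of being the image of m_j, so its error carries the standard deviation of
    that law besides V(m_j - u_j). An error of order eps is within reach only if this deviation is
    itself of order eps. Since its bound holds for every noise path, it enters the recursion for the
    means as a constant, and that recursion stays affine. Two features of the data shape the rest.
    Means and covariances are known only through their pairings with vectors; norms and traces are
    recovered from these by a Parseval family, which separability provides. And m_j comes with no
    measurability in the noise, so its error is bounded pointwise by functions of known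
    expectation. *)

Section Sequences.
Context {R : realType}.

(** The map [x -> q x + c] has the fixed point [c / (1 - q)]. Doubling it leaves room for the
    transient [q ^+ n * |x 0|], so the bound is reached after finitely many steps and not only in
    the limit. *)
Lemma affine_iter_eventually_le (q c : R) (x : nat -> R) : 0 <= q < 1 -> 0 < c ->
  (forall n, x n.+1 <= q * x n + c) ->
  exists N, forall n, (N <= n)%N -> x n <= 2 * c / (1 - q).
Proof.
move=> /andP[q0 q1] c0 hx.
have q1' : 0 < 1 - q by rewrite subr_gt0.
have hn n : x n <= q ^+ n * `|x 0%N| + c / (1 - q).
  elim: n => [|n ih].
    rewrite expr0 mul1r (le_trans (ler_norm _))// lerDl divr_ge0// ?ltW//.
  apply: (le_trans (hx n)); rewrite exprS.
  have -> : c / (1 - q) = q * (c / (1 - q)) + c by field; rewrite gt_eqF.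
  by rewrite addrA lerD2r -mulrA -mulrDr ler_wpM2l.
have : (fun n => q ^+ n * `|x 0%N|) @ \oo --> 0 * `|x 0%N|.
  by apply: cvgMr_tmp; apply: cvg_expr; rewrite ger0_norm.
rewrite mul0r => /cvgrPdist_lt /(_ (c / (1 - q))) [|N _ hN]; first by rewrite divr_gt0.
exists N => n Nn; have := hN n Nn; rewrite sub0r normrN ger0_norm ?mulr_ge0 ?exprn_ge0// => h.
apply: (le_trans (hn n)); rewrite -mulrA mulr2n mulrDl mul1r lerD2r ltW//.
Qed.

End Sequences.

(** * Positive semidefinite forms and nearest points *)

Section PositiveForms.
Context {R : realType} {V : lmodType R}.

(** Covers both [ip] and the form [vform] of the V-norm, so that Cauchy-Schwarz, Minkowski and the
    nearest-point argument are proved once. *)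
Definition psd_form (b : V -> V -> R) : Prop :=
  [/\ forall (c : R) (x y z : V), b (c *: x + y) z = c * b x z + b y z,
      forall x y : V, b x y = b y x
    & forall x : V, 0 <= b x x].

Context {b : V -> V -> R} (hb : psd_form b).

Lemma psdC x y : b x y = b y x. Proof. by case: hb. Qed.
Lemma psd_ge0 x : 0 <= b x x. Proof. by case: hb. Qed.
Lemma psdDl x y z : b (x + y) z = b x z + b y z.
Proof. by case: hb => h _ _; have := h 1 x y z; rewrite scale1r mul1r. Qed.
Lemma psd0l z : b 0 z = 0.
Proof. by have := psdDl 0 0 z; rewrite addr0 => h; lra. Qed.
Lemma psdZl c x z : b (c *: x) z = c * b x z.
Proof. by case: hb => h _ _; have := h c x 0 z; rewrite addr0 psd0l addr0. Qed.
Lemma psdNl x z : b (- x) z = - b x z.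
Proof. by rewrite -scaleN1r psdZl mulN1r. Qed.
Lemma psdDr x y z : b z (x + y) = b z x + b z y.
Proof. by rewrite !(psdC z) psdDl. Qed.
Lemma psdZr c x z : b z (c *: x) = c * b z x.
Proof. by rewrite !(psdC z) psdZl. Qed.
Lemma psdNr x z : b z (- x) = - b z x.
Proof. by rewrite !(psdC z) psdNl. Qed.
Lemma psd0r z : b z 0 = 0. Proof. by rewrite psdC psd0l. Qed.

Definition psdE := (psdDl, psdDr, psdNl, psdNr, psdZl, psdZr, psd0l, psd0r).

Lemma psd_suml I (s : seq I) (Q : pred I) (F : I -> V) z :
  b (\sum_(i <- s | Q i) F i) z = \sum_(i <- s | Q i) b (F i) z.
Proof.
by apply: (big_morph (fun x => b x z)) => [x y|]; rewrite ?psdDl ?psd0l.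
Qed.

Lemma psd_CauchySchwarz x y : b x y ^+ 2 <= b x x * b y y.
Proof.
have hx := psd_ge0 x; have hy := psd_ge0 y.
have key (s t : R) : 0 <= s ^+ 2 * b x x - 2 * s * t * b x y + t ^+ 2 * b y y.
  have := psd_ge0 (s *: x - t *: y); rewrite !psdE (psdC y x) => h; lra.
have [y0|y0] := eqVneq (b y y) 0.
  have [x0|x0] := eqVneq (b x y) 0; first by rewrite x0 y0 expr0n mulr0.
  (* With [b y y = 0] the quadratic is affine in [t]; at this [t] it equals [- b x x - 2], which is
     negative. *)
  have := key 1 ((b x x + 1) / b x y).
  rewrite y0 mulr0 addr0 expr1n mul1r mulr1 -mulrA divfK// => h; lra.
have yp : 0 < b y y by rewrite lt_neqAle eq_sym y0.
have := key (b y y) (b x y) => h.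
rewrite -(ler_pM2l yp) -subr_ge0; lra.
Qed.

Lemma psd_norm_ge x y : `|b x y| <= Num.sqrt (b x x) * Num.sqrt (b y y).
Proof.
rewrite -sqrtrM ?psd_ge0// -sqrtr_sqr ler_wsqrtr//; exact: psd_CauchySchwarz.
Qed.

Lemma psd_Minkowski x y :
  Num.sqrt (b (x + y) (x + y)) <= Num.sqrt (b x x) + Num.sqrt (b y y).
Proof.
have s0 : 0 <= Num.sqrt (b x x) + Num.sqrt (b y y) by rewrite addr_ge0.
rewrite -[leRHS](ger0_norm s0) -sqrtr_sqr ler_wsqrtr// sqrrD !sqr_sqrtr ?psd_ge0//.
rewrite !psdE (psdC y x).
by have := le_trans (ler_norm _) (psd_norm_ge x y) => h; lra.
Qed.

(* Variational inequality of a nearest point: compare with the point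
   [p + t (v - p)] of the segment from the nearest point [p] to [v], t -> 0. *)
Lemma nearest_point_le0 (B : V -> Prop) (u p v : V) :
  (forall t : R, 0 < t < 1 -> B (p + t *: (v - p))) ->
  (forall w, B w -> b (u - p) (u - p) <= b (u - w) (u - w)) ->
  b (u - p) (v - p) <= 0.
Proof.
move=> cB hp; rewrite leNgt; apply/negP => c0.
set c := b (u - p) (v - p) in c0; set n := b (v - p) (v - p).
have n0 : 0 <= n by exact: psd_ge0.
(* The first entry keeps [t] below 1; the second gives [t * n < 2 * c], against minimality at
   [p]. *)
pose t := Num.min 2^-1 (c / (n + 1)).
have cn : 0 < c / (n + 1) by rewrite divr_gt0//; lra.
have t0 : 0 < t by rewrite /t lt_min cn; apply/andP; split => //; lra.
have t1 : t < 1 by rewrite /t gt_min; apply/orP; left; lra.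
have tn : t * (n + 1) <= c by rewrite -ler_pdivlMr ?ge_min ?lexx ?orbT//; lra.
have := hp _ (cB t _); rewrite t0 t1 => /(_ isT).
rewrite opprD addrA.
have -> (a e : V) : b (a - t *: e) (a - t *: e) = b a a - 2 * t * b a e + t ^+ 2 * b e e.
  by rewrite !psdE (psdC e a); ring.
rewrite -/c -/n => h.
have : t * (2 * c) <= t * (t * n) by lra.
by rewrite ler_pM2l//; nra.
Qed.

(** The two variational inequalities add up to [b (p - q) (p - q) <= b (u - v) (p - q)]; positivity
    of [b] at [(u - v) - (p - q)] then removes the cross term. *)
Lemma nearest_point_nonexpansive (B : V -> Prop) (u v p q : V) :
  (forall x y (t : R), B x -> B y -> 0 < t < 1 -> B (x + t *: (y - x))) ->
  B p -> B q ->
  (forall w, B w -> b (u - p) (u - p) <= b (u - w) (u - w)) ->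
  (forall w, B w -> b (v - q) (v - q) <= b (v - w) (v - w)) ->
  b (p - q) (p - q) <= b (u - v) (u - v).
Proof.
move=> cB Bp Bq hp hq.
have h1 : b (u - p) (q - p) <= 0 by apply: nearest_point_le0 hp => t; exact: cB.
have h2 : b (v - q) (p - q) <= 0 by apply: nearest_point_le0 hq => t; exact: cB.
have h3 := psd_ge0 ((u - v) - (p - q)).
rewrite !psdE in h1 h2 h3 *.
have [[e1 e2] e3] := (psdC q p, psdC v u, psdC p u).
have [[e4 e5] e6] := (psdC q u, psdC p v, psdC q v).
lra.
Qed.

End PositiveForms.

(** * Inner product, Gram-Schmidt and Parseval's identity *)

Section HilbertSpace.
Context {R : realType} {V : completeNormedModType R}.
Context {ip : V -> V -> R} (hip : hilbert_ip ip).

Lemma ip_psd : psd_form ip.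
Proof. by case: hip => h1 h2 h3; split => // x; rewrite -h3 sqr_ge0. Qed.
Let ipE := psdE ip_psd.
Let ipC := psdC ip_psd.

Lemma ip_sqr x : ip x x = `|x| ^+ 2. Proof. by case: hip. Qed.

Lemma sqrt_ip x : Num.sqrt (ip x x) = `|x|.
Proof. by rewrite ip_sqr sqrtr_sqr normr_id. Qed.

Lemma ip_le_norm x y : ip x y <= `|x| * `|y|.
Proof.
by rewrite (le_trans (ler_norm _))// (le_trans (psd_norm_ge ip_psd x y))// !sqrt_ip.
Qed.

Lemma ip_norm_le x y : `|ip x y| <= `|x| * `|y|.
Proof. by rewrite (le_trans (psd_norm_ge ip_psd x y))// !sqrt_ip. Qed.

Lemma ip_ext x y : (forall h, ip x h = ip y h) -> x = y.
Proof.
move=> h; apply/eqP; rewrite -subr_eq0 -normr_eq0 -sqrf_eq0 -ip_sqr.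
by rewrite [ip _ _](psdDl ip_psd) (psdNl ip_psd) h subrr.
Qed.

Lemma continuous_ipl h : continuous (ip ^~ h).
Proof.
move=> x; apply/cvgrPdist_le => e e0; near=> y.
rewrite -(psdNl ip_psd) -(psdDl ip_psd) (le_trans (ip_norm_le _ _))//.
have : `|x - y| <= e / (`|h| + 1).
  near: y; apply: cvgr_dist_le; first exact: cvg_id.
  by rewrite divr_gt0// ltr_wpDl.
rewrite ler_pdivlMr ?ltr_wpDl// => /(le_trans _); apply.
by rewrite ler_wpM2l// lerDl.
Unshelve. all: by end_near. Qed.

Section GramSchmidt.
Variable d : nat -> V.

Definition gs_residual (s : seq V) (v : V) : V := v - \sum_(e <- s) ip v e *: e.

(* A linearly dependent vector has residual 0 and yields the vector 0, since
   [0^-1 = 0]: the family below is orthonormal up to null vectors. *)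
Definition gs_next (s : seq V) (v : V) : V :=
  `|gs_residual s v|^-1 *: gs_residual s v.

Fixpoint gs_list (n : nat) : seq V :=
  if n is m.+1 then rcons (gs_list m) (gs_next (gs_list m) (d m)) else [::].

Definition gs n := gs_next (gs_list n) (d n).

Lemma gs_listE n : gs_list n = mkseq gs n.
Proof. by elim: n => //= n ih; rewrite mkseqS -ih. Qed.

Lemma gs_sum n (F : V -> V) : \sum_(e <- gs_list n) F e = \sum_(i < n) F (gs i).
Proof. by rewrite -(big_mkord predT (F \o gs)) gs_listE big_map /index_iota subn0. Qed.

Lemma gs_residualE n : gs_residual (gs_list n) (d n) = d n - \sum_(i < n) ip (d n) (gs i) *: gs i.
Proof. by rewrite /gs_residual gs_sum. Qed.

Lemma gs_normalized n : ip (gs n) (gs n) = 1 \/ gs n = 0.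
Proof.
rewrite /gs /gs_next; move: (gs_residual _ _) => g.
have [->|g0] := eqVneq g 0; first by right; rewrite scaler0.
by left; rewrite !ipE ip_sqr; field; rewrite normr_eq0.
Qed.

Lemma gsE n : gs n = `|gs_residual (gs_list n) (d n)|^-1 *:
  (d n - \sum_(i < n) ip (d n) (gs i) *: gs i).
Proof. by rewrite -gs_residualE. Qed.

Local Opaque gs.

(** This is how null vectors are absorbed: the weight [ip (gs n) (gs n)] is 1 unless both sides
    vanish. *)
Lemma gs_projK z n : ip z (gs n) * ip (gs n) (gs n) = ip z (gs n).
Proof. by have [->|->] := gs_normalized n; rewrite ?mulr1// !ipE mul0r. Qed.

Lemma gs_orthogonal_lt n i : (i < n)%N -> ip (gs n) (gs i) = 0.
Proof.
(* Strong induction: the projection of [d n] meets [gs i] against every other earlier vector, with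
   indices in either order. *)
elim: n {-2}n (leqnn n) i => [[]//|N IH] n nN i ltin.
have ih j i' : (j < n)%N -> (i' < j)%N -> ip (gs j) (gs i') = 0.
  by move=> jn; apply: IH; rewrite -ltnS (leq_trans jn).
rewrite gsE (psdZl ip_psd) (psdDl ip_psd) (psdNl ip_psd) (psd_suml ip_psd).
rewrite (bigD1 (Ordinal ltin))//= (psdZl ip_psd) gs_projK big1 ?addr0 ?subrr ?mulr0// => j.
rewrite -val_eqE/= neq_ltn => /orP[ji|ij]; rewrite ipE; last by rewrite ih ?mulr0.
by rewrite (ipC (gs j)) ih ?mulr0.
Qed.

Lemma gs_orthogonal i j : i != j -> ip (gs i) (gs j) = 0.
Proof.
by rewrite neq_ltn => /orP[ij|ij]; [rewrite ipC|]; rewrite gs_orthogonal_lt.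
Qed.

Lemma gs_spanP n : exists c : nat -> R, d n = \sum_(i < n.+1) c i *: gs i.
Proof.
exists (fun i => if (i < n)%N then ip (d n) (gs i) else `|gs_residual (gs_list n) (d n)|).
rewrite big_ord_recr/= ltnn; under eq_bigr do rewrite ltn_ord.
have [g0|g0] := eqVneq (gs_residual (gs_list n) (d n)) 0.
  rewrite g0 normr0 scale0r addr0; move: g0; rewrite gs_residualE => /eqP.
  by rewrite subr_eq0 => /eqP.
by rewrite [X in _ *: X]gsE scalerA mulfV ?normr_eq0// scale1r addrC subrK.
Qed.

Lemma gs_dist z n (c : nat -> R) :
  `|z - \sum_(i < n) c i *: gs i| ^+ 2 =
  `|z| ^+ 2 - 2 * (\sum_(i < n) c i * ip z (gs i))
  + \sum_(i < n) c i ^+ 2 * ip (gs i) (gs i).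
Proof.
rewrite -!ip_sqr.
have hz w : ip w (\sum_(i < n) c i *: gs i) = \sum_(i < n) c i * ip w (gs i).
  by rewrite ipC psd_suml; [apply: eq_bigr => i _; rewrite ipE ipC|exact: ip_psd].
rewrite !(psdDl ip_psd) !(psdDr ip_psd) !(psdNl ip_psd) !(psdNr ip_psd).
rewrite (ipC _ z) !hz.
have -> : \sum_(i < n) c i * ip (\sum_(j < n) c j *: gs j) (gs i) =
          \sum_(i < n) c i ^+ 2 * ip (gs i) (gs i).
  apply: eq_bigr => i _; rewrite ipC hz (bigD1 i)//= big1 ?addr0.
    by rewrite expr2 mulrA.
  by move=> j ji; rewrite gs_orthogonal ?mulr0// eq_sym.
by ring.
Qed.

Lemma gs_Bessel z n : \sum_(i < n) ip z (gs i) ^+ 2 <= `|z| ^+ 2.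
Proof.
have := sqr_ge0 `|z - \sum_(i < n) ip z (gs i) *: gs i|.
rewrite (gs_dist z n (fun i => ip z (gs i))).
have -> : \sum_(i < n) ip z (gs i) * ip z (gs i) = \sum_(i < n) ip z (gs i) ^+ 2.
  by apply: eq_bigr => i _; rewrite expr2.
have -> : \sum_(i < n) ip z (gs i) ^+ 2 * ip (gs i) (gs i)
          = \sum_(i < n) ip z (gs i) ^+ 2.
  by apply: eq_bigr => i _; rewrite expr2 -mulrA gs_projK.
lra.
Qed.

(** The left side is the squared distance of [z] to the span. Coordinate by coordinate the claim is
    [0 <= (c i - ip z (gs i)) ^+ 2]. *)
Lemma gs_best_approximation z n (c : nat -> R) :
  `|z| ^+ 2 - \sum_(i < n) ip z (gs i) ^+ 2 <= `|z - \sum_(i < n) c i *: gs i| ^+ 2.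
Proof.
rewrite gs_dist -addrA lerD2l mulr_sumr -sumrN -sumrN -big_split/=.
apply: ler_sum => i _.
have := gs_projK z i; have [->|->] := gs_normalized i; last first.
  by rewrite !ipE => _; rewrite !mulr0 expr0n/= oppr0 addr0.
by move=> _; have := sqr_ge0 (c i - ip z (gs i)); rewrite sqrrB; lra.
Qed.

Lemma gs_Parseval z : closure (range d) z ->
  (\sum_(0 <= i <oo) (ip z (gs i) ^+ 2)%:E = (`|z| ^+ 2)%:E)%E.
Proof.
move=> dz; apply: cvg_lim => //.
under eq_fun do rewrite sumEFin big_mkord.
apply: cvg_EFin; first by apply: nearW.
apply/cvgrPdist_le => e e0.
have s0 : 0 < Num.sqrt e by rewrite sqrtr_gt0.
(* The radius is [sqrt e] because the Parseval defect is compared with a squared distance. The point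
   [d m] lies in the span of the first [m.+1] vectors, and longer partial sums only lower the
   defect. *)
have [_ [[m _ <-]]] := dz _ (nbhsx_ballx z _ s0).
rewrite -ball_normE/= => hm.
have [c hc] := gs_spanP m.
near=> n.
rewrite ger0_norm ?subr_ge0 ?gs_Bessel//.
have mn : (m.+1 <= n)%N by near: n; exists m.+1.
apply: (@le_trans _ _ (`|z| ^+ 2 - \sum_(i < m.+1) ip z (gs i) ^+ 2)).
  rewrite lerD2l lerN2 -!(big_mkord predT (fun i => ip z (gs i) ^+ 2)).
  rewrite [leRHS](big_cat_nat (n := m.+1))//= lerDl sumr_ge0// => i _.
  exact: sqr_ge0.
apply: (le_trans (gs_best_approximation z m.+1 c)); rewrite -hc.
rewrite -[leRHS](sqr_sqrtr (ltW e0)) lerXn2r ?nnegrE ?sqrtr_ge0//.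
exact: ltW.
Unshelve. all: by end_near. Qed.

End GramSchmidt.

Lemma separable_dense_sequence : separable_space V ->
  exists d : nat -> V, forall z, closure (range d) z.
Proof.
move=> [S [/countable_injP[f finj] clS]].
(* Decodes the injection [f] of [S] into nat. Numbers that code no point give 0, which is harmless:
   density only asks that the range contain [S]. *)
exists (fun n => xget 0 [set x | S x /\ f x = n]) => z.
have : closure S z by rewrite clS.
apply: closure_subset => x Sx; exists (f x) => //.
case: xgetP => [y -> [Sy fyx]|/(_ x)]; last by case; split.
by apply: finj; rewrite ?inE.
Qed.

Lemma exists_Parseval_family : separable_space V ->
  exists f : nat -> V, forall z,
    (\sum_(0 <= i <oo) (ip z (f i) ^+ 2)%:E = (`|z| ^+ 2)%:E)%E.
Proof.
move=> /separable_dense_sequence[d hd].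
by exists (gs d) => z; apply: gs_Parseval.
Qed.

End HilbertSpace.

(** * Monotone and bounded integrals *)

Section LowerIntegral.
Context {d} {T : measurableType d} {R : realType} (mu : {measure set T -> \bar R}).

(* No measurability is needed: the integral of a nonnegative function is a
   supremum over the simple functions below it. *)
Lemma ge0_le_integral_nonmeasurable (f g : T -> \bar R) :
  (forall x, 0 <= f x)%E -> (forall x, f x <= g x)%E ->
  (\int[mu]_x f x <= \int[mu]_x g x)%E.
Proof.
move=> f0 fg; have g0 x : (0 <= g x)%E := le_trans (f0 x) (fg x).
rewrite !ge0_integralTE//; apply: le_ereal_sup => _ [h hf <-].
by exists h => // x; exact: le_trans (hf x) (fg x).
Qed.

End LowerIntegral.

Section BoundedIntegrals.
Context {d} {T : measurableType d} {R : realType} (mu : probability T R).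

Definition bounded_measurable (f : T -> R) : Prop :=
  measurable_fun setT f /\ exists K, forall x, `|f x| <= K.

Lemma bounded_measurable_integrable f :
  bounded_measurable f -> mu.-integrable setT (EFin \o f).
Proof.
move=> [mf [K fK]]; apply: measurable_bounded_integrable => //=.
  by rewrite /= probability_setT ltry.
by exists K; split; [exact: num_real|move=> y Ky x _; exact: le_trans (ltW Ky)].
Qed.
Let bint := bounded_measurable_integrable.

Lemma integral_bounded f : bounded_measurable f ->
  (\int[mu]_x (f x)%:E)%E = (\int[mu]_x f x)%:E.
Proof.
by move=> hf; rewrite /Rintegral fineK//; exact: integrable_fin_num (bint _ hf).
Qed.

Lemma bounded_measurable_cst c : bounded_measurable (cst c).
Proof. by split; [exact: measurable_cst|exists `|c|]. Qed.

Lemma bounded_measurableD f g : bounded_measurable f -> bounded_measurable g ->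
  bounded_measurable (fun x => f x + g x).
Proof.
move=> [mf [K fK]] [mg [J gJ]]; split; first exact: measurable_funD.
by exists (K + J) => x; rewrite (le_trans (ler_normD _ _))// lerD.
Qed.

Lemma bounded_measurableM f g : bounded_measurable f -> bounded_measurable g ->
  bounded_measurable (fun x => f x * g x).
Proof.
move=> [mf [K fK]] [mg [J gJ]]; split; first exact: measurable_funM.
by exists (K * J) => x; rewrite normrM ler_pM.
Qed.

Lemma bounded_measurableZ c f : bounded_measurable f ->
  bounded_measurable (fun x => c * f x).
Proof. by apply: bounded_measurableM; exact: bounded_measurable_cst. Qed.

Lemma expectD f g : bounded_measurable f -> bounded_measurable g ->
  \int[mu]_x (f x + g x) = \int[mu]_x f x + \int[mu]_x g x.
Proof. by move=> hf hg; rewrite RintegralD//; exact: bint. Qed.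

Lemma expectZ c f : bounded_measurable f ->
  \int[mu]_x (c * f x) = c * \int[mu]_x f x.
Proof. by move=> hf; rewrite RintegralZl//; exact: bint. Qed.

Lemma expect_cst c : \int[mu]_x c = c.
Proof. by rewrite Rintegral_cst//= probability_setT mulr1. Qed.

Lemma le_expect f g : bounded_measurable f -> bounded_measurable g ->
  (forall x, f x <= g x) -> \int[mu]_x f x <= \int[mu]_x g x.
Proof.
by move=> hf hg fg; apply: le_Rintegral => //; exact: bint.
Qed.

End BoundedIntegrals.

(** * Weak means and covariances of Hilbert-valued variables *)

Section HilbertValued.
Context {R : realType} {V : completeNormedModType R}.
Context {ip : V -> V -> R} (hip : hilbert_ip ip) (hsep : separable_space V).
Let psd := ip_psd hip.
Let ipE := psdE (ip_psd hip).

Section OneSpace.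
Context {d} {T : measurableType d} (mu : probability T R).

Definition scalarly_measurable (g : T -> V) : Prop :=
  forall h, measurable_fun setT (fun x => ip (g x) h).

Lemma scalarly_measurableB g c : scalarly_measurable g ->
  scalarly_measurable (fun x => g x - c).
Proof.
move=> hg h; under eq_fun do rewrite !ipE.
by apply: measurable_funD => //; exact: measurable_cst.
Qed.

(** Parseval turns the squared norm into a countable sum of measurable squares. *)
Lemma measurable_norm_sqr g : scalarly_measurable g ->
  measurable_fun setT (fun x => `|g x| ^+ 2).
Proof.
move=> mg; have [f hf] := exists_Parseval_family hip hsep.
apply/measurable_EFinP.
rewrite (_ : _ \o _ = fun x => \sum_(0 <= i <oo) (ip (g x) (f i) ^+ 2)%:E)%E; last first.
  by apply/funext => x /=; rewrite hf.
apply: ge0_emeasurable_sum => [k x _ _|k _]; first by rewrite lee_fin sqr_ge0.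
by apply/measurable_EFinP; exact: measurable_funX.
Qed.

Lemma measurable_norm g : scalarly_measurable g ->
  measurable_fun setT (fun x => `|g x|).
Proof.
move=> /measurable_norm_sqr mg.
rewrite (_ : (fun _ => _) = (fun x => Num.sqrt (`|g x| ^+ 2))).
  by apply: measurableT_comp mg; apply: continuous_measurable_fun; exact: sqrt_continuous.
by apply/funext => x; rewrite sqrtr_sqr normr_id.
Qed.

Lemma integral_norm_sqr_Parseval (f : nat -> V) g :
  (forall z, \sum_(0 <= i <oo) (ip z (f i) ^+ 2)%:E = (`|z| ^+ 2)%:E)%E ->
  scalarly_measurable g ->
  (\int[mu]_x (`|g x| ^+ 2)%:E =
   \sum_(0 <= i <oo) \int[mu]_x (ip (g x) (f i) ^+ 2)%:E)%E.
Proof.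
move=> hf mg; rewrite -integral_nneseries//.
- by apply: eq_integral => x _; rewrite hf.
- by move=> n; apply/measurable_EFinP; exact: measurable_funX.
- by move=> n x _; rewrite lee_fin sqr_ge0.
Qed.

Definition weak_mean (g : T -> V) (c : V) : Prop :=
  forall h, (\int[mu]_x (ip (g x) h)%:E)%E = (ip c h)%:E.

Definition weak_covariance (g : T -> V) (c : V) (S : V -> V) : Prop :=
  forall h l, (\int[mu]_x (ip (g x - c) h * ip (g x - c) l)%:E)%E = (ip (S h) l)%:E.

Section BoundedVariable.
Variables (g : T -> V) (rho : R).
Hypotheses (mg : scalarly_measurable g) (grho : forall x, `|g x| <= rho).

Lemma bounded_measurable_ip h : bounded_measurable (fun x => ip (g x) h).
Proof.
split => //; exists (rho * `|h|) => x.
by rewrite (le_trans (ip_norm_le hip _ _))// ler_wpM2r.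
Qed.

Lemma bounded_measurable_norm : bounded_measurable (fun x => `|g x|).
Proof. by split; [exact: measurable_norm|exists rho => x; rewrite normr_id]. Qed.

Lemma bounded_measurable_norm_sqr : bounded_measurable (fun x => `|g x| ^+ 2).
Proof. by apply: bounded_measurableM; exact: bounded_measurable_norm. Qed.

Lemma weak_mean_expect c h : weak_mean g c -> \int[mu]_x ip (g x) h = ip c h.
Proof. by move=> /(_ h); rewrite /Rintegral => ->. Qed.

(** Pair the mean with itself: [|c| ^+ 2] is the expectation of [ip (g x) c], hence at most [|c|]
    times that of [|g x|]. *)
Lemma weak_mean_norm_le c K : weak_mean g c ->
  (\int[mu]_x `|g x|%:E <= K%:E)%E -> `|c| <= K.
Proof.
move=> gc; rewrite integral_bounded ?lee_fin; last exact: bounded_measurable_norm.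
move=> gK; have [->|c0] := eqVneq c 0.
  rewrite normr0 (le_trans _ gK)// -(expect_cst mu 0).
  apply: le_expect => //; first exact: bounded_measurable_cst.
  exact: bounded_measurable_norm.
have cp : 0 < `|c| by rewrite normr_gt0.
rewrite -(ler_pM2l cp) -expr2 -(ip_sqr hip) -(weak_mean_expect _ _ gc).
apply: (@le_trans _ _ (`|c| * \int[mu]_x `|g x|)); last by rewrite ler_wpM2l.
rewrite -expectZ; last exact: bounded_measurable_norm.
apply: le_expect.
- exact: bounded_measurable_ip.
- exact/bounded_measurableZ/bounded_measurable_norm.
- by move=> x; rewrite mulrC ip_le_norm.
Qed.

Lemma weak_mean_image (Q : V -> V) (u c : V) :
  (forall x y, ip (Q x) y = ip x (Q y)) -> weak_mean g c ->
  weak_mean (fun x => Q (g x - u)) (Q (c - u)).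
Proof.
move=> Qsym gc h.
have hx (y : V) : ip (Q (y - u)) h = ip y (Q h) + - ip u (Q h) by rewrite Qsym !ipE.
under eq_integral do rewrite hx.
rewrite integral_bounded; last first.
  by apply: bounded_measurableD; [exact: bounded_measurable_ip|exact: bounded_measurable_cst].
rewrite expectD ?expect_cst ?hx ?(weak_mean_expect _ _ gc)//.
  exact: bounded_measurable_ip.
exact: bounded_measurable_cst.
Qed.

End BoundedVariable.

Section Covariance.
Variables (g : T -> V) (rho : R) (c : V) (S : V -> V).
Hypotheses (mg : scalarly_measurable g) (grho : forall x, `|g x| <= rho).
Hypothesis gS : weak_covariance g c S.

Let gc x : `|g x - c| <= rho + `|c|.
Proof. by rewrite (le_trans (ler_normB _ _))// lerD2r. Qed.
Let bip h : bounded_measurable (fun x => ip (g x - c) h).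
Proof. by apply: bounded_measurable_ip gc _; exact: scalarly_measurableB. Qed.
Let bipM h l : bounded_measurable (fun x => ip (g x - c) h * ip (g x - c) l).
Proof. exact: bounded_measurableM. Qed.

(** [S] is an arbitrary function known only through this formula; symmetry, positivity, linearity
    and boundedness are all read off from it. *)
Lemma weak_covarianceE h l :
  ip (S h) l = \int[mu]_x (ip (g x - c) h * ip (g x - c) l).
Proof. by rewrite /Rintegral gS. Qed.

Lemma weak_covariance_sym h l : ip (S h) l = ip h (S l).
Proof.
rewrite (psdC psd h) !weak_covarianceE; apply: eq_Rintegral => x _.
by rewrite mulrC.
Qed.

Lemma weak_covariance_ge0 h : 0 <= ip (S h) h.
Proof.
rewrite weak_covarianceE -(expect_cst mu 0).
by apply: le_expect => // [|x]; [exact: bounded_measurable_cst|rewrite -expr2 sqr_ge0].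
Qed.

Lemma weak_covariance_linear : linear S.
Proof.
move=> a x y; apply: (ip_ext hip) => l; rewrite !ipE !weak_covarianceE.
rewrite -expectZ// -expectD//; last exact: bounded_measurableZ.
by apply: eq_Rintegral => z _; rewrite !ipE; ring.
Qed.

Lemma weak_covariance_norm_le h : `|S h| <= (rho + `|c|) ^+ 2 * `|h|.
Proof.
have [->|S0] := eqVneq (S h) 0.
  by rewrite normr0 mulr_ge0// sqr_ge0.
have Sp : 0 < `|S h| by rewrite normr_gt0.
rewrite -(ler_pM2r Sp) -expr2 -(ip_sqr hip) weak_covarianceE.
rewrite -(expect_cst mu ((rho + `|c|) ^+ 2 * `|h| * `|S h|)).
apply: le_expect => //; first exact: bounded_measurable_cst.
move=> x; rewrite (le_trans (ler_norm _))// normrM.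
rewrite (_ : _ * _ * _ = ((rho + `|c|) * `|h|) * ((rho + `|c|) * `|S h|)); last by ring.
apply: ler_pM => //; apply: (le_trans (ip_norm_le hip _ _)); rewrite ler_wpM2r//.
Qed.

(** Expand [g x - b] around [c]: the cross term has expectation zero ([e0] below), and what remains
    is the square of [b - c]. *)
Lemma weak_variance_minimal b : weak_mean g c ->
  (\int[mu]_x (`|g x - c| ^+ 2)%:E <= \int[mu]_x (`|g x - b| ^+ 2)%:E)%E.
Proof.
move=> gm.
have gb x : `|g x - b| <= rho + `|b| by rewrite (le_trans (ler_normB _ _))// lerD2r.
have bb : bounded_measurable (fun x => `|g x - b| ^+ 2).
  by apply: bounded_measurable_norm_sqr gb; exact: scalarly_measurableB.
have bc : bounded_measurable (fun x => `|g x - c| ^+ 2).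
  by apply: bounded_measurable_norm_sqr gc; exact: scalarly_measurableB.
rewrite !integral_bounded// lee_fin.
have e0 : \int[mu]_x ip (g x - c) (b - c) = 0.
  under eq_Rintegral do rewrite (psdDl psd) (psdNl psd).
  rewrite expectD ?expect_cst ?(weak_mean_expect _ _ _ gm) ?subrr//.
  - exact: bounded_measurable_ip grho _.
  - exact: bounded_measurable_cst.
rewrite -[leRHS]addr0 -(mulr0 2) -e0 -expectZ// -expectD//; last exact: bounded_measurableZ.
apply: le_expect => //; first by apply: bounded_measurableD => //; exact: bounded_measurableZ.
move=> x; rewrite -!(ip_sqr hip).
have := psd_ge0 psd (b - c); rewrite !ipE.
have [[e1 e2] e3] := (psdC psd c b, psdC psd c (g x), psdC psd b (g x)).
lra.
Qed.

End Covariance.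

End OneSpace.

(** Domination of covariance forms gives domination of traces. Two probability spaces are involved,
    since an analysis law will be compared with the forecast law it comes from. *)
Lemma integral_norm_sqr_le d1 d2 (T1 : measurableType d1) (T2 : measurableType d2)
    (mu1 : probability T1 R) (mu2 : probability T2 R) (g1 : T1 -> V) (g2 : T2 -> V) :
  scalarly_measurable g1 -> scalarly_measurable g2 ->
  (forall h, \int[mu1]_x (ip (g1 x) h ^+ 2)%:E <= \int[mu2]_x (ip (g2 x) h ^+ 2)%:E)%E ->
  (\int[mu1]_x (`|g1 x| ^+ 2)%:E <= \int[mu2]_x (`|g2 x| ^+ 2)%:E)%E.
Proof.
move=> m1 m2 h12; have [f hf] := exists_Parseval_family hip hsep.
rewrite !(integral_norm_sqr_Parseval _ _ _ hf)//.
apply: lee_nneseries => [i _ _|i _]; last exact: h12.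
by apply: integral_ge0 => x _; rewrite lee_fin sqr_ge0.
Qed.

End HilbertValued.

(** * Observation operator, its adjoint and the two projections *)

Section Observation.
Context {R : realType} {V : completeNormedModType R}.
Context {ip : V -> V -> R} (hip : hilbert_ip ip).
Context {k : nat} {H : {linear V -> 'cV[R]_k}} {Hs : 'cV[R]_k -> V}.
Hypothesis hadj : forall (u : V) (y : 'cV[R]_k), ip (Hs y) u = (y^T *m H u) ord0 ord0.
Hypothesis hHHs : forall y : 'cV[R]_k, H (Hs y) = y.
Let psd := ip_psd hip.
Let ipE := psdE (ip_psd hip).
Let ipC := psdC (ip_psd hip).

Lemma adj_linear : linear Hs.
Proof.
move=> a y z; apply: (ip_ext hip) => u.
by rewrite !ipE !hadj linearP/= mulmxDl -scalemxAl !mxE.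
Qed.

Lemma adjD y z : Hs (y + z) = Hs y + Hs z.
Proof. by have := adj_linear 1 y z; rewrite !scale1r. Qed.
Lemma adj0 : Hs 0 = 0.
Proof. by apply: (addrI (Hs 0)); rewrite -adjD !addr0. Qed.
Lemma adjZ a y : Hs (a *: y) = a *: Hs y.
Proof. by have := adj_linear a y 0; rewrite adj0 !addr0. Qed.
Lemma adjB y z : Hs (y - z) = Hs y - Hs z.
Proof. by rewrite adjD -scaleN1r adjZ scaleN1r. Qed.

Lemma adj_inj y : Hs y = 0 -> y = 0.
Proof. by move=> y0; rewrite -(hHHs y) y0 linear0. Qed.

Lemma ip_adj y z : ip (Hs y) (Hs z) = (y^T *m z) ord0 ord0.
Proof. by rewrite hadj hHHs. Qed.

Lemma ip_adj_proj y u : ip (Hs y) (Hs (H u)) = ip (Hs y) u.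
Proof. by rewrite ip_adj hadj. Qed.

Lemma proj_selfadjoint u v : ip (Hs (H u)) v = ip u (Hs (H v)).
Proof. by rewrite -ip_adj_proj ipC ip_adj_proj ipC. Qed.

Definition coproj (u : V) : V := u - Hs (H u).

Lemma coproj_selfadjoint u v : ip (coproj u) v = ip u (coproj v).
Proof. by rewrite /coproj !ipE proj_selfadjoint. Qed.

Lemma proj_coproj u : Hs (H (coproj u)) = 0.
Proof. by rewrite /coproj linearB/= hHHs subrr adj0. Qed.

Lemma coprojB u v : coproj (u - v) = coproj u - coproj v.
Proof. by rewrite /coproj linearB adjB !opprB addrACA [RHS]addrACA (addrC (- v)). Qed.

Lemma norm_sqr_split u : `|u| ^+ 2 = `|coproj u| ^+ 2 + `|Hs (H u)| ^+ 2.
Proof.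
rewrite -!(ip_sqr hip) /coproj !ipE (ipC u (Hs (H u))) ip_adj_proj; ring.
Qed.

Lemma proj_norm_le u : `|Hs (H u)| <= `|u|.
Proof.
rewrite -(@ler_pXn2r _ 2)// ?nnegrE// [leRHS]norm_sqr_split lerDr; exact: sqr_ge0.
Qed.

Lemma coproj_norm_le u : `|coproj u| <= `|u|.
Proof.
rewrite -(@ler_pXn2r _ 2)// ?nnegrE// [leRHS]norm_sqr_split lerDl; exact: sqr_ge0.
Qed.

Lemma obs_coord u i : H u i ord0 = ip u (Hs (delta_mx i ord0)).
Proof. by rewrite ipC hadj trmx_delta -rowE !mxE. Qed.

Lemma adj_norm_sqr (y : 'cV[R]_k) : `|Hs y| ^+ 2 = \sum_i y i ord0 ^+ 2.
Proof.
by rewrite -(ip_sqr hip) ip_adj mxE; apply: eq_bigr => i _; rewrite mxE expr2.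
Qed.

Lemma proj_norm_sqr_sum u : `|Hs (H u)| ^+ 2 = \sum_i ip u (Hs (delta_mx i ord0)) ^+ 2.
Proof. by rewrite adj_norm_sqr; apply: eq_bigr => i _; rewrite obs_coord. Qed.

Lemma coord_norm_le (y : 'cV[R]_k) i : `|y i ord0| <= `|Hs y|.
Proof.
rewrite -(@ler_pXn2r _ 2)// ?nnegrE// adj_norm_sqr (bigD1 i)//= real_normK ?num_real//.
by rewrite lerDl sumr_ge0// => j _; exact: sqr_ge0.
Qed.

Lemma linear_colE (W : lmodType R) (f : 'cV[R]_k -> W) (z : 'cV[R]_k) : linear f ->
  f z = \sum_l z l ord0 *: f (delta_mx l ord0).
Proof.
move=> lf.
have f0 : f 0 = 0 by have := lf (-1) 0 0; rewrite scaleN1r oppr0 addr0 scaleN1r addNr.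
have fZ a x : f (a *: x) = a *: f x by have := lf a x 0; rewrite f0 !addr0.
have fD x y : f (x + y) = f x + f y by have := lf 1 x y; rewrite !scale1r.
rewrite {1}(matrix_sum_delta z) (big_morph f fD f0).
by apply: eq_bigr => i _; rewrite big_ord1 fZ.
Qed.

(** [Hs] is an isometry, so [|Hs z|] is the Euclidean norm of [z]; the constant is the sum of the
    norms of the columns of [A]. *)
Lemma mulmx_adj_bounded (A : 'M[R]_k) :
  exists2 c, 0 <= c & forall z, `|Hs (A *m z)| <= c * `|Hs z|.
Proof.
exists (\sum_l `|Hs (A *m delta_mx l ord0)|); first exact: sumr_ge0.
move=> z; rewrite (linear_colE _ (fun z => Hs (A *m z))); last first.
  by move=> a x y; rewrite mulmxDr -scalemxAr adj_linear.
apply: (le_trans (ler_norm_sum _ _ _)); rewrite mulr_suml; apply: ler_sum => l _.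
by rewrite normrZ mulrC ler_wpM2l// coord_norm_le.
Qed.

(** * Kalman gain and analysis covariance of an inflated forecast *)

Section Gain.
Variables (Rm : 'M[R]_k) (eps a s : R) (Sig : V -> V).
Hypotheses (Rsym : Rm^T = Rm) (Rpsd : forall z, 0 <= ip (Hs z) (Hs (Rm *m z))).
Hypotheses (a0 : 0 < a) (Sig_linear : linear Sig).
Hypothesis Sig_sym : forall x y, ip (Sig x) y = ip x (Sig y).
Hypothesis Sig_ge0 : forall x, 0 <= ip (Sig x) x.
Hypothesis Sig_norm : forall x, `|Sig x| <= s * `|x|.

Variable S : V -> V.
Hypothesis SE : forall x, S x = Sig x + a *: Hs (H x).
Let M : 'M[R]_k :=
  \matrix_(i, l) ((H (S (Hs (delta_mx l 0)))) i 0 + eps ^+ 2 * Rm i l).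

Lemma inflated_linear : linear S.
Proof.
move=> c x y; rewrite !SE Sig_linear !linearP/= adj_linear !scalerDr !scalerA (mulrC a c).
by rewrite addrACA.
Qed.

Lemma inflated_sym x y : ip (S x) y = ip x (S y).
Proof. by rewrite !SE !ipE Sig_sym proj_selfadjoint. Qed.

Lemma inflated_adj z : S (Hs z) = Sig (Hs z) + a *: Hs z.
Proof. by rewrite !SE hHHs. Qed.

Lemma innovation_mulmx z : M *m z = H (S (Hs z)) + eps ^+ 2 *: (Rm *m z).
Proof.
have lf : linear (fun z => H (S (Hs z))).
  by move=> c x y; rewrite adj_linear inflated_linear linearP.
rewrite (linear_colE _ (fun z => H (S (Hs z))) z lf).
apply/colP => i; rewrite !mxE summxE mulr_sumr -big_split/=.
by apply: eq_bigr => l _; rewrite !mxE; ring.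
Qed.

Lemma innovation_form w y : ip (Hs w) (Hs (M *m y)) =
  ip (Hs w) (S (Hs y)) + eps ^+ 2 * ip (Hs w) (Hs (Rm *m y)).
Proof. by rewrite innovation_mulmx adjD adjZ !ipE ip_adj_proj. Qed.

Lemma noise_form_sym w y : ip (Hs w) (Hs (Rm *m y)) = ip (Hs (Rm *m w)) (Hs y).
Proof. by rewrite !ip_adj trmx_mul Rsym mulmxA. Qed.

Lemma innovation_sym w y : ip (Hs w) (Hs (M *m y)) = ip (Hs (M *m w)) (Hs y).
Proof.
by rewrite [RHS]ipC !innovation_form noise_form_sym -inflated_sym (ipC _ (Hs y)) (ipC _ (Hs y)).
Qed.

(** The inflation contributes [a] times the identity to [M], and the other two parts are positive
    semidefinite. Invertibility of [M] and the bound [1 / a] on its inverse follow. *)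
Lemma innovation_coercive z : a * `|Hs z| ^+ 2 <= ip (Hs z) (Hs (M *m z)).
Proof.
rewrite innovation_form inflated_adj !ipE (ip_sqr hip) (ipC _ (Sig _)).
by rewrite addrAC lerDr addr_ge0// mulr_ge0// sqr_ge0.
Qed.

Lemma innovation_unit : M \in unitmx.
Proof.
rewrite -unitmx_tr -row_free_unit -kermx_eq0; apply/eqP/eqP/rowV0P => u.
move=> /sub_kermxP uM; have Mu : M *m u^T = 0 by rewrite -[M]trmxK -trmx_mul uM trmx0.
have := innovation_coercive u^T; rewrite Mu adj0 (psd0r psd) pmulr_rle0// => u0.
have /adj_inj : Hs u^T = 0.
  by apply/eqP; rewrite -normr_eq0 -sqrf_eq0 eq_le u0 sqr_ge0.
by move=> /(congr1 trmx); rewrite trmxK trmx0.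
Qed.

(** Trades [invmx M] for a solution [z] of [M z = y]; the estimates on the gain are carried out on
    [z]. *)
Lemma gainP y : exists2 z, M *m z = y & Kgain H Hs eps Rm S y = S (Hs z).
Proof. by exists (invmx M *m y) => //; rewrite mulKVmx// innovation_unit. Qed.

Lemma gain_linear : linear (Kgain H Hs eps Rm S).
Proof.
by move=> c x y; rewrite /Kgain mulmxDr -scalemxAr adj_linear inflated_linear.
Qed.

Lemma innovation_inv_norm z : `|Hs z| <= `|Hs (M *m z)| / a.
Proof.
rewrite ler_pdivlMr// mulrC.
have [->|z0] := eqVneq (Hs z) 0; first by rewrite normr0 mulr0.
have zp : 0 < `|Hs z| by rewrite normr_gt0.
rewrite -(ler_pM2l zp) mulrCA -expr2 (le_trans (innovation_coercive z))//.
exact: ip_le_norm.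
Qed.

Lemma Sig_bound_ge0 y : 0 <= s * `|Hs y|.
Proof. exact: le_trans (Sig_norm (Hs y)). Qed.

Lemma gain_norm_le y : `|Kgain H Hs eps Rm S y| <= (s + a) / a * `|Hs y|.
Proof.
have [z <- ->] := gainP y.
rewrite inflated_adj (le_trans (ler_normD _ _))// normrZ gtr0_norm//.
apply: (@le_trans _ _ ((s + a) * `|Hs z|)); first by rewrite mulrDl lerD2r.
(* The sign of [s] is deduced from [Sig_norm] at a nonzero vector, so the zero vector is treated
   apart. *)
have [z0|z0] := eqVneq (Hs z) 0.
  rewrite z0 normr0 mulr0 (adj_inj _ z0) mulmx0 adj0 normr0 mulr0//.
have zp : 0 < `|Hs z| by rewrite normr_gt0.
have s0 : 0 <= s by rewrite -(pmulr_lge0 _ zp) Sig_bound_ge0.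
by rewrite mulrAC -mulrA ler_wpM2l ?innovation_inv_norm// addr_ge0// ltW.
Qed.

(** In [Hs (M z) - S (Hs z)] the inflation terms cancel, so the numerator [s + eps ^+ 2 * c] is free
    of [a]. For [y = H e] this makes [P - K H] of order [1 / a]. *)
Lemma gain_defect_norm_le c y : 0 <= c -> (forall z, `|Hs (Rm *m z)| <= c * `|Hs z|) ->
  `|Hs y - Kgain H Hs eps Rm S y| <= (s + eps ^+ 2 * c) / a * `|Hs y|.
Proof.
move=> c0 hc; have [z <- ->] := gainP y.
have -> : Hs (M *m z) - S (Hs z) = eps ^+ 2 *: Hs (Rm *m z) - coproj (Sig (Hs z)).
  rewrite innovation_mulmx adjD adjZ !inflated_adj linearD linearZ/= hHHs adjD adjZ.
  rewrite /coproj opprB opprD (addrAC _ _ (eps ^+ 2 *: _)) (addrC (- Sig _)).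
  by rewrite addrA addrK addrCA addrA.
apply: (@le_trans _ _ ((s + eps ^+ 2 * c) * `|Hs z|)).
  rewrite mulrDl [leRHS]addrC (le_trans (ler_normB _ _))// lerD//.
    by rewrite normrZ ger0_norm ?sqr_ge0// -mulrA ler_wpM2l// sqr_ge0.
  by rewrite (le_trans (coproj_norm_le _)).
have [z0|z0] := eqVneq (Hs z) 0.
  rewrite z0 normr0 mulr0 (adj_inj _ z0) mulmx0 adj0 normr0 mulr0//.
have zp : 0 < `|Hs z| by rewrite normr_gt0.
have s0 : 0 <= s by rewrite -(pmulr_lge0 _ zp) Sig_bound_ge0.
rewrite [leRHS]mulrAC -[leRHS]mulrA ler_wpM2l ?innovation_inv_norm//.
by rewrite addr_ge0// mulr_ge0// sqr_ge0.
Qed.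

Let C x := S x - Kgain H Hs eps Rm S (H (S x)).

(** The subtracted term equals [ip (Hs z) (Hs (M z))] with [M z = H (S h)], which is nonnegative by
    coercivity. *)
Lemma analysis_covariance_le h : ip (C h) h <= ip (S h) h.
Proof.
rewrite /C !ipE gerDl oppr_le0; have [z Mz ->] := gainP (H (S h)).
rewrite inflated_sym -ip_adj_proj -Mz (le_trans _ (innovation_coercive z))//.
by rewrite mulr_ge0 ?sqr_ge0// ltW.
Qed.

(* With [M z = A y], where [A = H S H^*] and [M = A + E], [E = eps^2 Rm], the
   vector [w = y - z] satisfies [M w = E y], so that
   [y.Ay - y.Az = y.Ey - w.Mw]. *)
Lemma analysis_covariance_observed y :
  ip (C (Hs y)) (Hs y) <= eps ^+ 2 * ip (Hs y) (Hs (Rm *m y)).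
Proof.
rewrite /C; have [z Mz ->] := gainP (H (S (Hs y))).
pose w := y - z.
have Mw : M *m w = eps ^+ 2 *: (Rm *m y).
  by rewrite mulmxBr Mz innovation_mulmx addrAC subrr add0r.
have -> : S (Hs y) - S (Hs z) = S (Hs w).
  have := inflated_linear (-1) (Hs z) (Hs y).
  by rewrite !scaleN1r /w adjB (addrC (- Hs z)) => ->; rewrite addrC.
have := innovation_form w y; rewrite innovation_sym Mw adjZ (psdZl psd).
rewrite inflated_sym (ipC _ (Hs y)) => e1.
have := innovation_coercive w; rewrite Mw adjZ (psdZr psd) => e2.
have : 0 <= a * `|Hs w| ^+ 2 by rewrite mulr_ge0 ?sqr_ge0// ltW.
lra.
Qed.

End Gain.

End Observation.

(** * Moments of the observation noise *)

Section Noise.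
Context {R : realType} {d : measure_display} {Om : measurableType d}.
Context {P : probability Om R}.

Definition has_expectation (f : Om -> R) (c : R) : Prop :=
  P.-integrable setT (EFin \o f) /\ (\int[P]_w (f w)%:E = c%:E)%E.

Lemma has_expectation_cst c : has_expectation (cst c) c.
Proof.
split; first exact: bounded_measurable_integrable (bounded_measurable_cst _).
by rewrite integral_bounded ?expect_cst//; exact: bounded_measurable_cst.
Qed.

Lemma has_expectationD f g x y : has_expectation f x -> has_expectation g y ->
  has_expectation (fun w => f w + g w) (x + y).
Proof.
move=> [if1 ef] [ig eg]; split; first exact: (integrableD measurableT if1 ig).
by rewrite (integralD_EFin measurableT if1 ig) ef eg.
Qed.

Lemma has_expectationZ a f x : has_expectation f x ->
  has_expectation (fun w => a * f w) (a * x).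
Proof.
move=> [if1 ef]; split; first exact: (integrableZl measurableT a if1).
by under eq_integral do rewrite EFinM; rewrite (integralZl measurableT if1) ef.
Qed.

Lemma has_expectation_sum I (s : seq I) (f : I -> Om -> R) (x : I -> R) :
  (forall i, has_expectation (f i) (x i)) ->
  has_expectation (fun w => \sum_(i <- s) f i w) (\sum_(i <- s) x i).
Proof.
move=> h; elim: s => [|i s ih].
  rewrite big_nil; under eq_fun do rewrite big_nil; exact: has_expectation_cst.
rewrite big_cons; under eq_fun do rewrite big_cons; exact: has_expectationD.
Qed.

Context {k : nat} {eta : nat -> Om -> 'cV[R]_k} {Rm : 'M[R]_k}.
Hypothesis heta : noise_model P eta Rm.

Lemma noise_covE j i l : has_expectation (fun w => eta j w i ord0 * eta j w l ord0) (Rm i l).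
Proof. by case: heta => _ _ h _; have [] := h j i l. Qed.

Lemma noise_cov_sym : Rm^T = Rm.
Proof.
apply/matrixP => i l; rewrite mxE; apply: EFin_inj.
rewrite -(noise_covE 0 l i).2 -(noise_covE 0 i l).2.
by apply: eq_integral => w _; rewrite mulrC.
Qed.

(** The form is the second moment of the scalar product of [z] with the noise. *)
Lemma noise_cov_psd (z : 'cV[R]_k) : 0 <= (z^T *m (Rm *m z)) ord0 ord0.
Proof.
have : has_expectation
    (fun w => \sum_i \sum_l (z i ord0 * z l ord0) * (eta 0%N w i ord0 * eta 0%N w l ord0))
    (\sum_i \sum_l (z i ord0 * z l ord0) * Rm i l).
  apply: has_expectation_sum => i; apply: has_expectation_sum => l.
  apply: has_expectationZ; exact: noise_covE.
move=> [_]; under eq_integral => w _.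
  rewrite (_ : \sum_i _ = (\sum_i z i ord0 * eta 0%N w i ord0) ^+ 2); last first.
    rewrite expr2 mulr_suml; apply: eq_bigr => i _; rewrite mulr_sumr.
    by apply: eq_bigr => l _; ring.
  over.
move=> h; rewrite mxE (_ : \sum_j _ = \sum_i \sum_l (z i ord0 * z l ord0) * Rm i l).
  by rewrite -lee_fin -h; apply: integral_ge0 => w _; rewrite lee_fin sqr_ge0.
apply: eq_bigr => i _; rewrite !mxE mulr_sumr; apply: eq_bigr => l _; ring.
Qed.

(** Dominates the Euclidean norm of the noise, as [x <= (1 + x ^+ 2) / 2], and has an expectation
    given exactly by the covariance. *)
Definition noise_size j w : R := (1 + \sum_i eta j w i ord0 ^+ 2) / 2.

Lemma noise_size_expectation j : has_expectation (noise_size j) ((1 + \tr Rm) / 2).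
Proof.
rewrite /noise_size mulrC; under eq_fun do rewrite mulrC.
apply: has_expectationZ; apply: has_expectationD; first exact: has_expectation_cst.
by apply: has_expectation_sum => i; under eq_fun do rewrite expr2; exact: noise_covE.
Qed.

Lemma noise_trace_ge0 : 0 <= \tr Rm.
Proof.
apply: sumr_ge0 => i _; rewrite -lee_fin -(noise_covE 0 i i).2.
by apply: integral_ge0 => w _; rewrite lee_fin -expr2 sqr_ge0.
Qed.

End Noise.

Section BorelContinuous.
Context {R : realType} {V : completeNormedModType R}.

Lemma continuous_borel_measurable (f : V -> R) : continuous f ->
  measurable_fun (setT : set (borelV V)) (f : borelV V -> R).
Proof.
move=> /continuousP cf.
apply: (measurability _ (RGenOpens.measurableE R)) => _ [_ [a [b ->] <-]].
rewrite setTI; apply: sub_sigma_algebra; apply: cf; exact: interval_open.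
Qed.

End BorelContinuous.

Lemma limn_esup_le {R : realType} (u : nat -> \bar R) (l : \bar R) (N : nat) :
  (forall n, (N <= n)%N -> (u n <= l)%E) -> (limn_esup u <= l)%E.
Proof.
move=> h; apply: (@le_trans _ _ (ereal_sup [set u n | n in [set n | (N <= n)%N]])).
  by apply: ereal_inf_lbound; exists [set n | (N <= n)%N] => //; exists N.
by apply: ge_ereal_sup => _ [n Nn <-]; exact: h.
Qed.

(** * The V-norm, the ball projection and the projected map *)

Section ProjectedDynamics.
Context {R : realType} {V : completeNormedModType R}.
Context {ip : V -> V -> R} (hip : hilbert_ip ip) (hsep : separable_space V).
Context {k : nat} {H : {linear V -> 'cV[R]_k}} {Hs : 'cV[R]_k -> V}.
Hypothesis hadj : forall (u : V) (y : 'cV[R]_k), ip (Hs y) u = (y^T *m H u) ord0 ord0.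
Hypothesis hHHs : forall y : 'cV[R]_k, H (Hs y) = y.
Context {Psi : V -> V} {r beta L alpha : R}.
Hypothesis hA : assumptionA Psi (fun u => Hs (H u)) r beta L alpha.
Context {PB : V -> V}.
Hypothesis hPB : is_Vproj_ball beta (fun u => Hs (H u)) r PB.
Let psd := ip_psd hip.
Let ipE := psdE (ip_psd hip).
Let ipC := psdC (ip_psd hip).
Let proj_le := proj_norm_le hip hadj hHHs.
Local Notation Q := (@coproj R V k H Hs).
Local Notation N := (Vnorm beta (fun u : V => Hs (H u))).

Lemma beta_ge0 : 0 <= beta. Proof. by case: hA => -[]. Qed.
Lemma radius_gt0 : 0 < r. Proof. by case: hA => -[]. Qed.
Lemma lipschitz_gt0 : 0 < L. Proof. by case: hA => -[]. Qed.
Lemma alpha_in01 : 0 < alpha < 1. Proof. by case: hA => -[]. Qed.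

Definition vform (u v : V) : R := ip u v + beta * ip (Hs (H u)) (Hs (H v)).

Lemma vform_psd : psd_form vform.
Proof.
split => [c x y z|x y|x]; rewrite /vform.
- by rewrite linearP/= (adj_linear hip hadj) !ipE; ring.
- by rewrite ipC (ipC (Hs _)).
- by rewrite addr_ge0 ?mulr_ge0 ?(psd_ge0 psd)// beta_ge0.
Qed.

Lemma VnormE u : N u = Num.sqrt (vform u u).
Proof. by rewrite /Vnorm /vform !(ip_sqr hip). Qed.

Lemma Vnorm_sqr u : N u ^+ 2 = vform u u.
Proof. by rewrite VnormE sqr_sqrtr ?(psd_ge0 vform_psd). Qed.

Lemma Vnorm_ge0 u : 0 <= N u. Proof. exact: sqrtr_ge0. Qed.

Lemma Vnorm_triangle u v : N (u + v) <= N u + N v.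
Proof. by rewrite !VnormE; exact: psd_Minkowski vform_psd _ _. Qed.

Lemma Vnorm_sqr_ge u : `|u| ^+ 2 <= N u ^+ 2.
Proof.
rewrite Vnorm_sqr /vform !(ip_sqr hip) lerDl mulr_ge0 ?sqr_ge0//; exact: beta_ge0.
Qed.

Lemma Vnorm_ge u : `|u| <= N u.
Proof. by rewrite -(@ler_pXn2r _ 2)// ?nnegrE ?Vnorm_ge0// Vnorm_sqr_ge. Qed.

Lemma Vnorm_le u : N u <= Num.sqrt (1 + beta) * `|u|.
Proof.
rewrite VnormE -[in leRHS](normr_id u) -sqrtr_sqr -sqrtrM; last by rewrite addr_ge0 ?beta_ge0.
apply: ler_wsqrtr; rewrite /vform !(ip_sqr hip) mulrDl mul1r lerD2l.
by rewrite ler_wpM2l ?beta_ge0// lerXn2r ?nnegrE.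
Qed.

Lemma Vnorm_coproj u : N (Q u) = `|Q u|.
Proof.
by rewrite /Vnorm (proj_coproj hip hadj hHHs) normr0 expr0n/= mulr0 addr0 sqrtr_sqr normr_id.
Qed.

Lemma Vnorm_sqr_split u : N u ^+ 2 = `|Q u| ^+ 2 + (1 + beta) * `|Hs (H u)| ^+ 2.
Proof.
rewrite Vnorm_sqr /vform !(ip_sqr hip) {1}(norm_sqr_split hip hadj hHHs u); ring.
Qed.

Lemma ball_convex (x y : V) (t : R) : `|x| <= r -> `|y| <= r -> 0 < t < 1 ->
  `|x + t *: (y - x)| <= r.
Proof.
move=> xr yr /andP[t0 t1].
have -> : x + t *: (y - x) = (1 - t) *: x + t *: y.
  by rewrite scalerBr scalerBl scale1r addrA addrAC.
rewrite (le_trans (ler_normD _ _))// !normrZ !gtr0_norm ?subr_gt0//.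
have := ler_wpM2l (ltW t0) yr; have : (1 - t) * `|x| <= (1 - t) * r.
  by rewrite ler_wpM2l// subr_ge0 ltW.
lra.
Qed.

Lemma ball_projection_id u : `|u| <= r -> PB u = u.
Proof.
move=> ur; have [_ /(_ u ur)] := hPB u; rewrite subrr => h.
have : `|u - PB u| <= 0.
  rewrite (le_trans (Vnorm_ge _))// (le_trans h)//.
  by rewrite VnormE (psd0l vform_psd) sqrtr0.
by rewrite normr_le0 subr_eq0 => /eqP.
Qed.

Lemma ball_projection_nonexpansive u v : N (PB u - PB v) ^+ 2 <= N (u - v) ^+ 2.
Proof.
have min w z : `|z| <= r -> vform (w - PB w) (w - PB w) <= vform (w - z) (w - z).
  move=> zr; have [_ /(_ z zr)] := hPB w.
  by rewrite -!Vnorm_sqr => h; rewrite lerXn2r// nnegrE Vnorm_ge0.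
rewrite !Vnorm_sqr; apply: (nearest_point_nonexpansive vform_psd (fun z => `|z| <= r)).
- by move=> x y t; exact: ball_convex.
- by case: (hPB u).
- by case: (hPB v).
- exact: min.
- exact: min.
Qed.

(** Gaussian samples leave the ball, where [Psi] is not controlled. [PB] is nonexpansive in the
    V-norm, so this map has the constants of [Psi] on the whole space, and its values stay in the
    ball. *)
Definition projected_map (u : V) : V := Psi (PB u).
Local Notation psi := projected_map.

Lemma projected_map_norm u : `|psi u| <= r.
Proof. by case: hA => _ [_ h _ _]; apply: h; case: (hPB u). Qed.

Lemma projected_map_id u : `|u| <= r -> psi u = Psi u.
Proof. by move=> ur; rewrite /psi ball_projection_id. Qed.

Lemma projected_map_Vnorm u v : N (psi u - psi v) <= Num.sqrt L * N (u - v).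
Proof.
have L0 := ltW lipschitz_gt0.
rewrite -(@ler_pXn2r _ 2)// ?nnegrE ?mulr_ge0 ?sqrtr_ge0 ?Vnorm_ge0//.
rewrite exprMn (sqr_sqrtr L0); case: hA => _ [_ _ h _].
have [[hu _] [hv _]] := (hPB u, hPB v).
by apply: (le_trans (h _ _ hu hv)); rewrite ler_wpM2l// ball_projection_nonexpansive.
Qed.

Lemma projected_map_coproj u v : `|Q (psi u - psi v)| ^+ 2 <= alpha * N (u - v) ^+ 2.
Proof.
have /andP[/ltW al0 _] := alpha_in01.
rewrite -Vnorm_coproj; case: hA => _ [_ _ _ h].
have [[hu _] [hv _]] := (hPB u, hPB v).
by apply: (le_trans (h _ _ hu hv)); rewrite ler_wpM2l// ball_projection_nonexpansive.
Qed.

Lemma projected_map_coproj_norm u v :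
  `|Q (psi u - psi v)| <= Num.sqrt alpha * N (u - v).
Proof.
have /andP[/ltW al0 _] := alpha_in01.
rewrite -(@ler_pXn2r _ 2)// ?nnegrE ?mulr_ge0 ?sqrtr_ge0 ?Vnorm_ge0//.
by rewrite exprMn (sqr_sqrtr al0) projected_map_coproj.
Qed.

Lemma Vlipschitz_continuous (f : V -> V) (c : R) : 0 <= c ->
  (forall u v, `|f u - f v| <= c * N (u - v)) -> continuous f.
Proof.
move=> c0 fc x.
have K0 : 0 <= c * Num.sqrt (1 + beta) by rewrite mulr_ge0 ?sqrtr_ge0.
apply/cvgrPdist_le => e e0; near=> y.
rewrite (le_trans (fc x y))// (le_trans (ler_wpM2l c0 (Vnorm_le _)))// mulrA.
have : `|x - y| <= e / (c * Num.sqrt (1 + beta) + 1).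
  near: y; apply: cvgr_dist_le; first exact: cvg_id.
  by rewrite divr_gt0// (ltr_wpDl K0).
rewrite ler_pdivlMr ?(ltr_wpDl K0)// => /(le_trans _); apply.
by rewrite mulrC ler_wpM2l// lerDl.
Unshelve. all: by end_near. Qed.

Lemma projected_map_measurable : @scalarly_measurable R V ip _ (borelV V) psi.
Proof.
move=> h; apply: continuous_borel_measurable => x.
apply: (@continuous_comp _ _ _ psi (ip ^~ h)); last exact: continuous_ipl.
apply: (Vlipschitz_continuous psi (Num.sqrt L)); first exact: sqrtr_ge0.
move=> u v; exact: le_trans (Vnorm_ge _) (projected_map_Vnorm u v).
Qed.

Lemma id_measurable : @scalarly_measurable R V ip _ (borelV V) id.
Proof. by move=> h; apply: continuous_borel_measurable; exact: continuous_ipl. Qed.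

Lemma Vnorm_sqr_measurable (c : V) :
  measurable_fun (setT : set (borelV V)) (fun x : borelV V => N ((x : V) - c) ^+ 2).
Proof.
under eq_fun do rewrite Vnorm_sqr_split.
have mx : @scalarly_measurable R V ip _ (borelV V) (fun x => (x : V) - c).
  by apply: (scalarly_measurableB hip (fun x : borelV V => x : V)); exact: id_measurable.
have mQ : @scalarly_measurable R V ip _ (borelV V) (fun x => Q ((x : V) - c)).
  by move=> h; under eq_fun do rewrite (coproj_selfadjoint hip hadj hHHs); exact: mx.
have mP : @scalarly_measurable R V ip _ (borelV V) (fun x => Hs (H ((x : V) - c))).
  by move=> h; under eq_fun do rewrite (proj_selfadjoint hip hadj hHHs); exact: mx.
apply: measurable_funD; first exact: measurable_norm_sqr mQ.
by apply: measurable_funM; [exact: measurable_cst|exact: measurable_norm_sqr mP].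
Qed.

(** * One forecast and analysis step *)

Section Step.
Variables (Rm : 'M[R]_k) (eps a : R) (G : probability (borelV V) R) (mu : V) (Sig : V -> V).
Hypotheses (Rsym : Rm^T = Rm) (Rpsd : forall z, 0 <= ip (Hs z) (Hs (Rm *m z))).
Hypothesis a0 : 0 < a.
Hypothesis hmu : @weak_mean R V ip _ (borelV V) G psi mu.
Hypothesis hSig : @weak_covariance R V ip _ (borelV V) G psi mu Sig.
Local Notation S := (fun x => Sig x + a *: Hs (H x)).
Local Notation K := (Kgain H Hs eps Rm S).

(** Extended real, because no bound on the spread of the initial law is at hand; boundedness of the
    forecast supplies one after a single step. *)
Definition spread (G : probability (borelV V) R) (m : V) : \bar R :=
  (\int[G]_x (N ((x : V) - m) ^+ 2)%:E)%E.

Let psi_norm (x : borelV V) : `|psi x| <= r. Proof. exact: projected_map_norm. Qed.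

Lemma forecast_mean_ball : `|mu| <= r.
Proof.
apply: (weak_mean_norm_le hip hsep G psi r projected_map_measurable psi_norm _ _ hmu).
rewrite -[X in (_ <= X%:E)%E](expect_cst G) -integral_bounded; last exact: bounded_measurable_cst.
by apply: ge0_le_integral_nonmeasurable => x; rewrite lee_fin.
Qed.

Lemma forecast_covariance_norm x : `|Sig x| <= (r + r) ^+ 2 * `|x|.
Proof.
apply: (le_trans (weak_covariance_norm_le hip G psi r mu Sig
  projected_map_measurable psi_norm hSig x)).
rewrite ler_wpM2r// lerXn2r ?nnegrE ?addr_ge0 ?(ltW radius_gt0)//.
by rewrite lerD2l forecast_mean_ball.
Qed.

Let Slin := weak_covariance_linear hip G psi r mu Sig projected_map_measurable psi_norm hSig.
Let Ssym := weak_covariance_sym hip G psi mu Sig hSig.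
Let Sge0 := weak_covariance_ge0 hip G psi r mu Sig projected_map_measurable psi_norm hSig.

Lemma coproj_deviation_measurable c :
  @scalarly_measurable R V ip _ (borelV V) (fun x => Q (psi x - c)).
Proof.
move=> h; under eq_fun do rewrite (coproj_selfadjoint hip hadj hHHs).
by apply: (scalarly_measurableB hip); exact: projected_map_measurable.
Qed.

(** The variance is least about the mean, so [mu] may be replaced by the image of [m], and then the
    contraction applies pointwise. The centre 0 below stands for this image, which [g] already
    subtracts. *)
Lemma forecast_coproj_spread (m : V) :
  (\int[G]_x (`|Q (psi (x : V) - mu)| ^+ 2)%:E <= alpha%:E * spread G m)%E.
Proof.
have /andP[/ltW al0 _] := alpha_in01.
pose g (x : borelV V) := Q (psi x - psi m).
have gr x : `|g x| <= r + r.
  rewrite (le_trans (coproj_norm_le hip hadj hHHs _))// (le_trans (ler_normB _ _))//.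
  by rewrite lerD.
have gm : @weak_mean R V ip _ (borelV V) G g (Q (mu - psi m)).
  exact: (weak_mean_image hip G psi r projected_map_measurable psi_norm Q (psi m) mu
    (coproj_selfadjoint hip hadj hHHs) hmu).
have := weak_variance_minimal hip hsep G g (r + r) _ (coproj_deviation_measurable _) gr 0 gm.
have gE (x : borelV V) : g x - Q (mu - psi m) = Q (psi x - mu).
  by rewrite /g -(coprojB hip hadj) opprB addrA subrK.
under eq_integral do rewrite gE.
move=> h; apply: (le_trans h); rewrite /spread -ge0_integralZl_EFin//.
- apply: ge0_le_integral_nonmeasurable => x; rewrite lee_fin ?sqr_ge0// subr0.
  exact: projected_map_coproj.
- by move=> x _; rewrite lee_fin sqr_ge0.
- by apply/measurable_EFinP; exact: Vnorm_sqr_measurable.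
Qed.

Lemma forecast_coproj_spread_bounded :
  (\int[G]_x (`|Q (psi (x : V) - mu)| ^+ 2)%:E <= ((r + r) ^+ 2)%:E)%E.
Proof.
rewrite -[X in (_ <= X%:E)%E](expect_cst G) -integral_bounded; last exact: bounded_measurable_cst.
apply: ge0_le_integral_nonmeasurable => x; rewrite lee_fin ?sqr_ge0//.
rewrite lerXn2r ?nnegrE ?addr_ge0 ?(ltW radius_gt0)//.
rewrite (le_trans (coproj_norm_le hip hadj hHHs _))// (le_trans (ler_normB _ _))//.
by rewrite lerD// forecast_mean_ball.
Qed.

Lemma analysis_spread (G' : probability (borelV V) R) (m' : V) :
  @weak_covariance R V ip _ (borelV V) G' id m' (fun x => S x - K (H (S x))) ->
  (spread G' m' <= \int[G]_x (`|Q (psi (x : V) - mu)| ^+ 2)%:E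
                   + ((1 + beta) * (eps ^+ 2 * \tr Rm))%:E)%E.
Proof.
move=> hC; pose C x := S x - K (H (S x)).
have b1 : 0 <= 1 + beta by rewrite addr_ge0// beta_ge0.
have mx : @scalarly_measurable R V ip _ (borelV V) (fun x => (x : V) - m').
  by apply: (scalarly_measurableB hip (fun x : borelV V => x : V)); exact: id_measurable.
have mQ : @scalarly_measurable R V ip _ (borelV V) (fun x => Q ((x : V) - m')).
  by move=> h; under eq_fun do rewrite (coproj_selfadjoint hip hadj hHHs); exact: mx.
have mP : @scalarly_measurable R V ip _ (borelV V) (fun x => Hs (H ((x : V) - m'))).
  by move=> h; under eq_fun do rewrite (proj_selfadjoint hip hadj hHHs); exact: mx.
have hCh h : (\int[G']_x (ip ((x : V) - m') h ^+ 2)%:E = (ip (C h) h)%:E)%E.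
  by rewrite -(hC h h); apply: eq_integral => x _; rewrite expr2.
rewrite /spread; under eq_integral do rewrite Vnorm_sqr_split EFinD (EFinM (1 + beta)).
rewrite ge0_integralD//; last 3 first.
- by apply/measurable_EFinP; exact: measurable_norm_sqr mQ.
- by move=> x _; rewrite -EFinM lee_fin mulr_ge0 ?sqr_ge0.
- apply/measurable_EFinP; apply: measurable_funM; first exact: measurable_cst.
  exact: measurable_norm_sqr mP.
apply: leeD.
  apply: (integral_norm_sqr_le hip hsep) => //; first exact: coproj_deviation_measurable.
  move=> h; under eq_integral do rewrite (coproj_selfadjoint hip hadj hHHs).
  rewrite hCh; under [in leRHS]eq_integral do rewrite (coproj_selfadjoint hip hadj hHHs) expr2.
  rewrite hSig lee_fin; apply: le_trans (_ : ip (S (Q h)) (Q h) <= _).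
    exact: (analysis_covariance_le hip hadj hHHs Rm eps a Sig Rpsd a0 Slin Ssym Sge0).
  (* The inflation vanishes on the range of [Q], so it costs nothing in this part of the spread. *)
  by rewrite ipE (proj_coproj hip hadj hHHs) scaler0 (psd0l psd) addr0.
rewrite ge0_integralZl_EFin//; last first.
  by apply/measurable_EFinP; exact: measurable_norm_sqr mP.
rewrite (EFinM (1 + beta)); apply: lee_wpmul2l; first by rewrite lee_fin.
under eq_integral do rewrite (proj_norm_sqr_sum hip hadj hHHs) -sumEFin.
rewrite ge0_integral_sum//; last 2 first.
- by move=> i; apply/measurable_EFinP/measurable_funX; exact: mx.
- by move=> i x _; rewrite lee_fin sqr_ge0.
under eq_bigr do rewrite hCh.
(* Summing the observed bound over the standard basis of the observation space produces the trace of
   [Rm]. *)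
rewrite sumEFin lee_fin mulr_sumr; apply: ler_sum => i _.
apply: (le_trans (y := eps ^+ 2 *
  ip (Hs (delta_mx i ord0)) (Hs (Rm *m delta_mx i ord0)))).
  exact: (analysis_covariance_observed hip hadj hHHs Rm eps a Sig Rsym Rpsd a0 Slin Ssym Sge0).
rewrite (ip_adj hadj hHHs) trmx_delta -rowE -colE !mxE//.
Qed.

Section AnalysisMean.
Variables (m u : V) (y : 'cV[R]_k).
Hypothesis ur : `|u| <= r.
Let m' := mu + K (H (Psi u) + eps *: y - H mu).

Let Klin := gain_linear hip hadj Rm eps a Sig Slin (fun x => Sig x + a *: Hs (H x)) (fun=> erefl).

Let gain_le := gain_norm_le hip hadj hHHs Rm eps a ((r + r) ^+ 2) Sig
  Rpsd a0 Slin Sge0 forecast_covariance_norm _ (fun=> erefl).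

Let defect_le := gain_defect_norm_le hip hadj hHHs Rm eps a ((r + r) ^+ 2) Sig
  Rpsd a0 Slin Sge0 forecast_covariance_norm _ (fun=> erefl).

(** Here [y] is the noise vector; the observation is [H (Psi u) + eps *: y]. *)
Lemma analysis_error : m' - Psi u = (mu - Psi u) - K (H (mu - Psi u)) + eps *: K y.
Proof.
have KN z : K (- z) = - K z.
  have K0 : K 0 = 0 by have := Klin (-1) 0 0; rewrite scaleN1r oppr0 addr0 scaleN1r addNr.
  by have := Klin (-1) z 0; rewrite !scaleN1r K0 !addr0.
have e1 : H (Psi u) + eps *: y - H mu = eps *: y - H (mu - Psi u).
  by rewrite linearB/= opprB [LHS]addrAC addrC.
by rewrite /m' e1 Klin KN addrAC (addrC (eps *: _)) addrA.
Qed.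

Lemma mean_deviation_Vnorm (t : R) : 0 < t -> (spread G m <= (t ^+ 2)%:E)%E ->
  (\int[G]_x (N ((x : V) - u))%:E <= (N (m - u) + t)%:E)%E.
Proof.
move=> t0 hT.
(* AM-GM: [N (x - m) <= t / 2 + N (x - m) ^+ 2 / (2 t)]. *)
have hx x : N (x - u) <= (N (m - u) + t / 2) + (2 * t)^-1 * N (x - m) ^+ 2.
  have -> : x - u = (m - u) + (x - m) by rewrite [RHS]addrC addrA subrK.
  rewrite (le_trans (Vnorm_triangle _ _))// -addrA lerD2l.
  rewrite -subr_ge0.
  have -> : t / 2 + (2 * t)^-1 * N (x - m) ^+ 2 - N (x - m)
    = (2 * t)^-1 * (N (x - m) - t) ^+ 2 by field; rewrite gt_eqF.
  by rewrite mulr_ge0 ?sqr_ge0// invr_ge0 mulr_ge0// ltW.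
have c0 : 0 <= N (m - u) + t / 2 by rewrite addr_ge0 ?Vnorm_ge0// divr_ge0// ltW.
have i0 : 0 <= (2 * t)^-1 by rewrite invr_ge0 mulr_ge0// ltW.
have mN := Vnorm_sqr_measurable m.
apply: (@le_trans _ _ (\int[G]_x ((N (m - u) + t / 2)%:E
   + (2 * t)^-1%:E * (N ((x : V) - m) ^+ 2)%:E))%E).
  apply: ge0_le_integral_nonmeasurable => x; first by rewrite lee_fin Vnorm_ge0.
  by rewrite -EFinM -EFinD lee_fin.
rewrite ge0_integralD//; first last.
- by apply/measurable_EFinP; apply: measurable_funM => //; exact: measurable_cst.
- by move=> x _; rewrite -EFinM lee_fin mulr_ge0 ?sqr_ge0.
rewrite (_ : \int[G]_x (N (m - u) + t / 2)%:E = (N (m - u) + t / 2)%:E)%E; last first.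
  by rewrite integral_bounded ?expect_cst//; exact: bounded_measurable_cst.
rewrite ge0_integralZl_EFin//; first last.
- by apply/measurable_EFinP.
- by move=> x _; rewrite lee_fin sqr_ge0.
apply: (le_trans (y := ((N (m - u) + t / 2)%:E + (2 * t)^-1%:E * (t ^+ 2)%:E)%E)).
  by apply: leeD => //; apply: lee_wpmul2l; rewrite ?lee_fin.
rewrite -EFinM -EFinD lee_fin -addrA lerD2l le_eqVlt; apply/orP; left; apply/eqP.
by field; rewrite gt_eqF.
Qed.

Let psi_u : psi u = Psi u. Proof. exact: projected_map_id. Qed.

Lemma integral_le_scaled (f : borelV V -> R) (c t : R) : 0 <= c -> 0 < t ->
  (spread G m <= (t ^+ 2)%:E)%E -> (forall x, 0 <= f x) ->
  (forall x : V, f x <= c * N (x - u)) ->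
  (\int[G]_x (f x)%:E <= (c * (N (m - u) + t))%:E)%E.
Proof.
move=> c0 t0 hT f0 fN.
apply: (@le_trans _ _ (\int[G]_x (c%:E * (N ((x : V) - u))%:E))%E).
  apply: ge0_le_integral_nonmeasurable => x; first by rewrite lee_fin.
  by rewrite -EFinM lee_fin; exact: fN.
have mN : measurable_fun (setT : set (borelV V)) (fun x : borelV V => N ((x : V) - u)).
  rewrite (_ : (fun _ => _) = (fun x : borelV V => Num.sqrt (N ((x : V) - u) ^+ 2))).
    apply: measurableT_comp; last exact: Vnorm_sqr_measurable.
    by apply: continuous_measurable_fun; exact: sqrt_continuous.
  by apply/funext => x; rewrite sqrtr_sqr ger0_norm// Vnorm_ge0.
rewrite ge0_integralZl_EFin//; first last.
- by apply/measurable_EFinP.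
- by move=> x _; rewrite lee_fin Vnorm_ge0.
by rewrite EFinM; apply: lee_wpmul2l; [rewrite lee_fin|exact: mean_deviation_Vnorm].
Qed.

(** As [u] lies in the ball, [mu - Psi u] is the mean of [psi x - psi u]; its norm is at most the
    mean norm, which the Lipschitz bounds reduce to the mean of [N (x - u)]. *)
Lemma forecast_mean_error (t : R) : 0 < t -> (spread G m <= (t ^+ 2)%:E)%E ->
  `|mu - Psi u| <= Num.sqrt L * (N (m - u) + t) /\
  `|Q (mu - Psi u)| <= Num.sqrt alpha * (N (m - u) + t).
Proof.
move=> t0 hT.
have gr (x : borelV V) : `|psi x - psi u| <= r + r.
  by rewrite (le_trans (ler_normB _ _))// lerD.
have mg : @scalarly_measurable R V ip _ (borelV V) (fun x => psi x - psi u).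
  by apply: (scalarly_measurableB hip); exact: projected_map_measurable.
have gQr (x : borelV V) : `|Q (psi x - psi u)| <= r + r.
  by rewrite (le_trans (coproj_norm_le hip hadj hHHs _)).
rewrite -psi_u; split.
  apply: (weak_mean_norm_le hip hsep G _ (r + r) mg gr).
    exact: (weak_mean_image hip G psi r projected_map_measurable psi_norm id (psi u) mu
      (fun _ _ => erefl) hmu).
  apply: integral_le_scaled => // x.
  exact: le_trans (Vnorm_ge _) (projected_map_Vnorm _ _).
apply: (weak_mean_norm_le hip hsep G _ (r + r) (coproj_deviation_measurable _) gQr).
  exact: (weak_mean_image hip G psi r projected_map_measurable psi_norm Q (psi u) mu
    (coproj_selfadjoint hip hadj hHHs) hmu).
apply: integral_le_scaled => // x.
exact: projected_map_coproj_norm.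
Qed.

Let B := Num.sqrt (1 + beta).
Let B0 : 0 <= B. Proof. exact: sqrtr_ge0. Qed.

(** Uses only that [mu] and [Psi u] lie in the ball. It settles large [eps], and for small [eps] it
    starts the recursion without any knowledge of the previous error. *)
Lemma analysis_mean_crude : 0 < eps ->
  N (m' - Psi u) <= B * (1 + ((r + r) ^+ 2 + a) / a) * (r + r)
    + eps * (B * (((r + r) ^+ 2 + a) / a)) * `|Hs y|.
Proof.
move=> e0; set q := _ / a.
have q0 : 0 <= q by rewrite divr_ge0 ?addr_ge0 ?sqr_ge0// ltW.
have hPsi : `|Psi u| <= r by rewrite -psi_u.
have hc : `|mu - Psi u| <= r + r.
  by rewrite (le_trans (ler_normB _ _))// lerD// forecast_mean_ball.
rewrite (le_trans (Vnorm_le _))// -/B.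
rewrite [leRHS](_ : _ = B * ((1 + q) * (r + r) + eps * (q * `|Hs y|))); last by ring.
rewrite ler_wpM2l// analysis_error (le_trans (ler_normD _ _))// lerD//.
  rewrite mulrDl mul1r (le_trans (ler_normB _ _))// lerD//.
  rewrite (le_trans (gain_le _))// ler_wpM2l//.
  exact: le_trans (proj_le _) hc.
by rewrite normrZ gtr0_norm// ler_wpM2l// ltW.
Qed.

Lemma analysis_mean_contraction (t c : R) : 0 < eps <= 1 -> 0 <= c ->
  (forall z, `|Hs (Rm *m z)| <= c * `|Hs z|) ->
  0 < t -> (spread G m <= (t ^+ 2)%:E)%E ->
  N (m' - Psi u) <=
    (Num.sqrt alpha + B * (((r + r) ^+ 2 + c) / a) * Num.sqrt L) * (N (m - u) + t)
    + eps * (B * (((r + r) ^+ 2 + a) / a)) * `|Hs y|.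
Proof.
move=> /andP[e0 e1] c0 hc t0 hT.
have [hL hQ] := forecast_mean_error t t0 hT.
rewrite analysis_error; set e := mu - Psi u in hL hQ *.
(* On the range of [Q] the V-norm is the plain norm, so the first term keeps the factor
   [sqrt alpha]; only the defect pays the norm-equivalence constant [B], and it is of order
   [1 / a]. *)
have -> : e - K (H e) + eps *: K y = Q e + ((Hs (H e) - K (H e)) + eps *: K y).
  by rewrite /coproj addrA addrA subrK.
rewrite (le_trans (Vnorm_triangle _ _))// Vnorm_coproj mulrDl -[leRHS]addrA lerD//.
rewrite (le_trans (Vnorm_triangle _ _))// lerD//.
  rewrite (le_trans (Vnorm_le _))// -!mulrA ler_wpM2l//.
  rewrite (le_trans (defect_le c _ c0 hc))//.
  have s0 : 0 <= (r + r) ^+ 2 := sqr_ge0 _.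
  rewrite -mulrA; apply: ler_pM => //.
  - by rewrite addr_ge0// mulr_ge0// sqr_ge0.
  - by rewrite mulr_ge0// invr_ge0 ltW.
  (* [eps <= 1] makes the contraction factor independent of [eps]. *)
  - rewrite lerD2l ler_piMl// expr_le1// ltW//.
  by rewrite ler_wpM2l ?invr_ge0 ?(ltW a0)// (le_trans (proj_le _)).
rewrite (le_trans (Vnorm_le _))// normrZ gtr0_norm// -/B mulrCA -(mulrA eps) -(mulrA B).
rewrite ler_wpM2l ?(ltW e0)// ler_wpM2l//; exact: gain_le.
Qed.

End AnalysisMean.

End Step.

End ProjectedDynamics.

(** * Constants and recursions along the trajectory *)

Theorem theorem3p2
  (R : realType) (V : completeNormedModType R)
  (ip : V -> V -> R) (hip : hilbert_ip ip) (hsep : separable_space V)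
  (k : nat) (H : {linear V -> 'cV[R]_k}) (Hs : 'cV[R]_k -> V)
  (hadj : forall (u : V) (y : 'cV[R]_k), ip (Hs y) u = (y^T *m H u) ord0 ord0)
  (hHHs : forall y : 'cV[R]_k, H (Hs y) = y)
  (Psi : V -> V) (r beta L alpha : R)
  (hA : assumptionA Psi (fun u => Hs (H u)) r beta L alpha)
  (PB : V -> V) (hPB : is_Vproj_ball beta (fun u => Hs (H u)) r PB)
  (u0 : V) (Rm : 'M[R]_k)
  (d : measure_display) (Om : measurableType d) (P : probability Om R)
  (eta : nat -> Om -> 'cV[R]_k) (heta : noise_model P eta Rm)
  (m0 : V) (C0 : V -> V) :
  exists a0 : R, forall a : R, 0 < a -> a0 < a ->
  exists C1 : R, forall eps : R, 0 < eps ->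
  forall (G : nat -> Om -> probability (borelV V) R)
         (m : nat -> Om -> V) (C : nat -> Om -> V -> V)
         (mu : nat -> Om -> V) (Sig : nat -> Om -> V -> V),
  GPF ip H Hs Rm eps a Psi PB m0 C0
      (fun j w => H (iter j Psi u0) + eps *: eta j w) G m C mu Sig ->
  (limn_esup (fun j : nat => \int[P]_w (`|m j w - iter j Psi u0|)%:E)
     <= (C1 * eps)%:E)%E.
Proof.
have Rsym := noise_cov_sym heta.
have Rpsd z : 0 <= ip (Hs z) (Hs (Rm *m z)).
  by rewrite (ip_adj hadj hHHs); exact: noise_cov_psd heta z.
have tr0 := noise_trace_ge0 heta.
have [c c0 hc] := mulmx_adj_bounded hip hadj hHHs Rm.
have be0 := beta_ge0 hA; have r0 := radius_gt0 hA; have L0 := lipschitz_gt0 hA.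
have /andP[al0 al1] := alpha_in01 hA.
have [n0 hn0] : exists n0, forall j, (n0 <= j)%N -> `|iter j Psi u0| <= r.
  case: hA => _ [/(_ `|u0|)[n0 h] _ _ _]; exists n0 => j nj; exact: h.
pose s := (r + r) ^+ 2; pose B := Num.sqrt (1 + beta).
have s0 : 0 <= s := sqr_ge0 _.
have B0 : 0 < B by rewrite sqrtr_gt0; lra.
have sal1 : Num.sqrt alpha < 1 by rewrite -[ltRHS]sqrtr1 ltr_sqrt.
have sal0 : 0 <= Num.sqrt alpha by exact: sqrtr_ge0.
have sL0 : 0 <= Num.sqrt L by exact: sqrtr_ge0.
(* The condition [gamma < 1] solved for [a]. *)
exists (B * (s + c) * Num.sqrt L / (1 - Num.sqrt alpha)) => a a0 ha.
pose gamma := Num.sqrt alpha + B * ((s + c) / a) * Num.sqrt L.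
have gamma01 : 0 <= gamma < 1.
  apply/andP; split.
    by rewrite addr_ge0// !mulr_ge0 ?addr_ge0 ?invr_ge0// ltW.
  rewrite /gamma -ltrBrDl.
  have -> : B * ((s + c) / a) * Num.sqrt L = B * (s + c) * Num.sqrt L / a.
    by field; rewrite gt_eqF.
  by rewrite ltr_pdivrMr// [ltRHS]mulrC -ltr_pdivrMr ?subr_gt0.
have /andP[gamma0 gamma1] := gamma01.
pose kappa := B * ((s + a) / a); pose nu := (1 + \tr Rm) / 2.
have kappa0 : 0 < kappa by rewrite mulr_gt0// divr_gt0// ltr_wpDl.
have nu0 : 0 < nu by rewrite divr_gt0// ltr_wpDr.
pose b := (1 + beta) * \tr Rm; have b0 : 0 <= b by rewrite mulr_ge0// addr_ge0.
(* [(eps * b') ^+ 2] is the eventual bound of the spread recursion with additive term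
   [(b + 1) * eps ^+ 2]; the added 1 keeps this term positive even when the trace of [Rm] is
   zero. *)
pose b' := Num.sqrt (2 * (b + 1) / (1 - alpha)).
have b'2 : 0 < 2 * (b + 1) / (1 - alpha).
  by rewrite divr_gt0 ?subr_gt0// mulr_gt0// ltr_wpDl.
have b'0 : 0 < b' by rewrite sqrtr_gt0.
pose D0 := B * (1 + (s + a) / a) * (r + r).
have D00 : 0 <= D0.
  rewrite /D0 !mulr_ge0 ?addr_ge0 ?(ltW B0) ?(ltW r0)//.
  by rewrite mulr_ge0 ?addr_ge0 ?invr_ge0 ?(ltW a0).
(* [E * eps] is the eventual bound of the recursion for the means. *)
pose E := 2 * (gamma * b' + kappa * nu) / (1 - gamma).
have E0 : 0 <= E.
  by rewrite divr_ge0 ?subr_ge0 ?(ltW gamma1)// mulr_ge0// addr_ge0//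
    mulr_ge0 ?(ltW b'0) ?(ltW kappa0) ?(ltW nu0).
(* The first two terms serve [eps > 1], where [D0 <= D0 * eps]; the last one serves [eps <= 1]. *)
exists (D0 + kappa * nu + E) => eps e0 G m C mu Sig hG.
pose N := Vnorm beta (fun u : V => Hs (H u)).
pose Sp := @spread R V k H Hs beta.
have hmean w j : @weak_mean R V ip _ (borelV V) (G j w) (@projected_map _ _ Psi PB) (mu j.+1 w).
  by have [_ [_ h _ _ _]] := hG w; exact: h.
have hcov w j : @weak_covariance R V ip _ (borelV V) (G j w) (@projected_map _ _ Psi PB)
    (mu j.+1 w) (Sig j.+1 w).
  by have [_ [_ _ h _ _]] := hG w; exact: h.
have hm w j := let: conj _ (And5 _ _ _ h _) := hG w in h j.
have hgauss w j : @weak_covariance R V ip _ (borelV V) (G j.+1 w) id (m j.+1 w)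
    (fun x => Sig j.+1 w x + a *: Hs (H x) -
       Kgain H Hs eps Rm (fun x => Sig j.+1 w x + a *: Hs (H x))
         (H (Sig j.+1 w x + a *: Hs (H x)))).
  have [_ [hg _ _ _ hC]] := hG w; have [_ h] := hg j.+1.
  by move: h; rewrite hC.
have noise_le j w : `|Hs (eta j w)| <= noise_size (eta := eta) j w.
  rewrite /noise_size -(adj_norm_sqr hip hadj hHHs).
  by have := sqr_ge0 (`|Hs (eta j w)| - 1); rewrite sqrrB1; lra.
have noiseE j := noise_size_expectation heta j.
have ek0 : 0 <= eps * kappa by rewrite mulr_ge0// ltW.
have crude w j : (n0 <= j)%N ->
    N (m j.+1 w - iter j.+1 Psi u0) <= D0 + eps * kappa * noise_size (eta := eta) j.+1 w.
  move=> nj; rewrite hm iterS.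
  have := analysis_mean_crude hip hsep hadj hHHs hA hPB Rm eps a (G j w) (mu j.+1 w)
    (Sig j.+1 w) Rpsd a0 (hmean w j) (hcov w j) (iter j Psi u0) (eta j.+1 w) (hn0 j nj) e0.
  by move=> h; apply: (le_trans h); rewrite lerD2l ler_wpM2l.
have bound j (F : Om -> R) x : has_expectation (P := P) F x ->
    (forall w, N (m j w - iter j Psi u0) <= F w) ->
    (\int[P]_w (`|m j w - iter j Psi u0|)%:E <= x%:E)%E.
  move=> [_ <-] h; apply: ge0_le_integral_nonmeasurable => w; rewrite lee_fin//.
  exact: le_trans (Vnorm_ge hip hadj hA _) (h w).
have crudeE j : has_expectation (P := P)
    (fun w => D0 + eps * kappa * noise_size (eta := eta) j w) (D0 + eps * kappa * nu).
  apply: has_expectationD; first exact: has_expectation_cst.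
  exact: has_expectationZ.
have [e1|e1] := ltP 1 eps.
  apply: (limn_esup_le _ _ n0.+1) => -[//|j]; rewrite ltnS => nj.
  apply: (le_trans (bound _ _ _ (crudeE _) (fun w => crude w j nj))).
  rewrite lee_fin mulrDl mulrDl -addrA lerD//.
    by rewrite ler_peMr// ltW.
  by rewrite -mulrA (mulrC eps) lerDl mulr_ge0// ltW.
(* [tau n] bounds the spread at time [n.+1]: the recursion starts after the first analysis, with [s]
   bounding the forecast spread in the range of [Q]. *)
pose tau := fix tau n := if n is n'.+1 then alpha * tau n' + b * eps ^+ 2
                         else s + b * eps ^+ 2.
have hbe : (1 + beta) * (eps ^+ 2 * \tr Rm) = b * eps ^+ 2 by rewrite /b; ring.
have spread_le w n : (Sp (G n.+1 w) (m n.+1 w) <= (tau n)%:E)%E.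
  elim: n => [|n ih] /=.
    apply: (le_trans (analysis_spread hip hsep hadj hHHs hA hPB Rm eps a (G 0%N w) (mu 1%N w)
      (Sig 1%N w) Rsym Rpsd a0 (hcov w 0%N) _ _ (hgauss w 0%N))).
    rewrite hbe EFinD leeD//.
    exact: (forecast_coproj_spread_bounded hip hsep hadj hHHs hA hPB _ _ (hmean w 0%N)).
  apply: (le_trans (analysis_spread hip hsep hadj hHHs hA hPB Rm eps a (G n.+1 w) (mu n.+2 w)
    (Sig n.+2 w) Rsym Rpsd a0 (hcov w n.+1) _ _ (hgauss w n.+1))).
  rewrite hbe EFinD leeD//.
  apply: (le_trans (forecast_coproj_spread hip hsep hadj hHHs hA hPB _ _
    (hmean w n.+1) (m n.+1 w))).
  by rewrite EFinM; apply: lee_wpmul2l => //; rewrite lee_fin ltW.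
pose t := eps * b'.
have t0 : 0 < t by rewrite mulr_gt0.
have [n1 hn1] : exists n1, forall n, (n1 <= n)%N -> tau n <= t ^+ 2.
  have [|||n1 h] := @affine_iter_eventually_le R alpha ((b + 1) * eps ^+ 2) tau.
  - by rewrite (ltW al0).
  - by rewrite mulr_gt0 ?exprn_gt0// ltr_wpDl.
  - by move=> n /=; rewrite lerD2l mulrDl lerDl mul1r sqr_ge0.
  exists n1 => n /h h'; apply: (le_trans h').
  rewrite exprMn (sqr_sqrtr (ltW b'2)) le_eqVlt; apply/orP; left; apply/eqP.
  by field; rewrite subr_eq0 gt_eqF.
(* From time [J.+1] on, the signal is in the ball and the spread is below [t ^+ 2]; the successor
   accounts for the shift in [tau]. *)
pose J := maxn n0 n1.
pose f := fix f n := if n is n'.+1 then gamma * f n' + (gamma * t + eps * kappa * nu)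
                     else D0 + eps * kappa * nu.
(* The recursion runs on majorants [F], affine in the noise sizes, whose expectations follow the
   numerical recursion [f] exactly. *)
have main n : exists2 F : Om -> R, has_expectation (P := P) F (f n) &
    forall w, N (m (n + J.+1)%N w - iter (n + J.+1) Psi u0) <= F w.
  elim: n => [|n [F FE hF]].
    by exists (fun w => D0 + eps * kappa * noise_size (eta := eta) J.+1 w) => // w;
      apply: crude; rewrite leq_maxl.
  exists (fun w => gamma * F w
    + (gamma * t + eps * kappa * noise_size (eta := eta) (n + J.+1).+1 w)).
    apply: has_expectationD; first exact: has_expectationZ.
    by apply: has_expectationD; [exact: has_expectation_cst|exact: has_expectationZ].
  move=> w; rewrite addSn hm iterS.
  have ur : `|iter (n + J.+1) Psi u0| <= r.
    by apply: hn0; rewrite (leq_trans (leq_maxl n0 n1))// addnS leqW// leq_addl.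
  have sp : (Sp (G (n + J.+1)%N w) (m (n + J.+1)%N w) <= (t ^+ 2)%:E)%E.
    rewrite addnS (le_trans (spread_le w _))// lee_fin hn1//.
    by rewrite (leq_trans (leq_maxr n0 n1))// leq_addl.
  have e01 : 0 < eps <= 1 by rewrite e0.
  have h := analysis_mean_contraction hip hsep hadj hHHs hA hPB Rm eps a
    (G (n + J.+1)%N w) (mu (n + J.+1).+1 w) (Sig (n + J.+1).+1 w) Rpsd a0
    (hmean w _) (hcov w _) (m (n + J.+1)%N w) (iter (n + J.+1) Psi u0) (eta (n + J.+1).+1 w)
    ur t c e01 c0 hc t0 sp.
  apply: (le_trans h); rewrite [leRHS]addrA -[X in _ <= X + _]mulrDr.
  apply: lerD; first by apply: ler_wpM2l => //; rewrite lerD2r; exact: hF.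
  by apply: ler_wpM2l => //; exact: noise_le.
have [|||n2 hn2] := @affine_iter_eventually_le R gamma (gamma * t + eps * kappa * nu) f.
- exact: gamma01.
- apply: ltr_wpDl; first by rewrite mulr_ge0// ltW.
  by rewrite mulr_gt0// mulr_gt0.
- by move=> n.
apply: (limn_esup_le _ _ (n2 + J.+1)) => j hj.
have jJ : (J.+1 <= j)%N by rewrite (leq_trans _ hj)// leq_addl.
have [F FE hF] := main (j - J.+1)%N; rewrite subnK// in hF.
apply: (le_trans (bound _ _ _ FE hF)); rewrite lee_fin.
have /hn2 h : (n2 <= j - J.+1)%N by rewrite leq_subRL// addnC.
apply: (le_trans h).
have -> : 2 * (gamma * t + eps * kappa * nu) / (1 - gamma) = E * eps.
  by rewrite /E /t; field; rewrite subr_eq0 gt_eqF.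
by rewrite ler_wpM2r ?(ltW e0)// lerDr addr_ge0// mulr_ge0// ltW.
Qed.
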